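(* Let $(M,\phi)$ be a $1$-dimensional, definably connected, $\omega$-saturated t.t.t. structure such that for every point $x\in M_t$ we have $d_M(M_t\setminus\{x\})>1$. Then there exists a finite set $X\subset M_t$ such that each of the finitely many definably connected components of $M_t\setminus X$ is o-minimal.
   Context: A first order topological structure is a pair $(M,\phi)$ where $M$ is a two-sorted $L$-structure with sorts $M_t$ (points) and $M_b$ (parameters) and $\phi(x,y_1,\dots,y_k)$ is an $L$-formula such that $\{\phi^{M_t}(x,\bar a):\bar a\in M_b^k\}$ is a basis for a topology on $M_t$; these sets are called basis sets. Standing assumptions: $M_t$ is Hausdorff, and (A) every definable (with parameters) $X\subset M_t$ is a Boolean combination of definable open sets. For a closed definable $X\subset M_t$ the ordinal-valued rank $D_M(X)$ is defined by: $D_M(X)\ge 0$ iff $X\neq\emptyset$; for limit $\delta$, $D_M(X)\ge\delta$ if $D_M(X)\ge\alpha$ for all $\alpha<\delta$; $D_M(X)\ge\alpha+1$ if there is a closed definable $Y\subset X$ with empty interior in $X$ and $D_M(Y)\ge\alpha$. $M$ has dimension if $D_M(X)\ne\infty$ for every closed definable $X$; $M$ is $1$-dimensional if $D_M(M_t)=1$. For definable $X\subset M_t$, $d_M(X)$ is the maximal $d<\omega$ such that $X$ is the union of $d$ pairwise disjoint nonempty definable sets each clopen in $X$ ($\infty$ if no maximum exists). $M$ is t.t.t. (topologically totally transcendental) if it is such a first order topological structure satisfying (A), with dimension, and $d_M(X)<\infty$ for all definable $X\subset M_t$. ''Connected'' always means definably connected (no partition into two nonempty definable relatively clopen sets); the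 definably connected components of a definable set $X$ are the pieces of a partition realizing $d_M(X)$. A definable open set $U\subset M_t$ is o-minimal if there is a definable dense linear order $<$ on $U$ whose order topology coincides with the subspace topology on $U$ and such that every definable subset of $U$ is a finite union of points and open $<$-intervals (with endpoints in $U\cup\{\pm\infty\}$). *)

(* Defs.v *)
From mathcomp Require Import all_boot all_order.
From mathcomp Require Import boolp classical_sets functions.
From mathcomp Require Import cardinality wochoice filter topology.

Set Implicit Arguments.
Unset Strict Implicit.
Unset Printing Implicit Defensive.

Local Open Scope classical_set_scope.

(** [St] is the sort of points, [Sb] the sort of parameters. *)
Inductive tsort : Type := St | Sb.

Record language : Type := Language {
  fsym : Type;
  farity : fsym -> nat;
  fdom : forall f : fsym, 'I_(farity f) -> tsort;
  fcod : fsym -> tsort;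
  rsym : Type;
  rarity : rsym -> nat;
  rdom : forall r : rsym, 'I_(rarity r) -> tsort
}.

(** Variables are pairs of a sort and a number. *)
Inductive term (L : language) : tsort -> Type :=
| Var (s : tsort) (n : nat) : term L s
| App (f : fsym L) (u : forall i : 'I_(farity f), term L (fdom i)) :
    term L (fcod f).

(** The other connectives and the existential quantifier are the usual
    classical abbreviations. *)
Inductive formula (L : language) : Type :=
| Fbot
| Feq (s : tsort) (t u : term L s)
| Frel (r : rsym L) (u : forall i : 'I_(rarity r), term L (rdom i))
| Fimp (f g : formula L)
| Fall (s : tsort) (n : nat) (f : formula L).

Fixpoint tfree (L : language) (s : tsort) (n : nat) (s' : tsort)
    (t : term L s') : Prop :=
  match t with
  | Var s1 m => s1 = s /\ m = n
  | App f u => exists i, tfree s n (u i)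
  end.

Fixpoint free (L : language) (s : tsort) (n : nat) (f : formula L) : Prop :=
  match f with
  | Fbot => False
  | Feq _ t u => tfree s n t \/ tfree s n u
  | Frel r u => exists i, tfree s n (u i)
  | Fimp g h => free s n g \/ free s n h
  | Fall s1 m g => free s n g /\ ~ (s1 = s /\ m = n)
  end.

Definition dom (Mt Mb : Type) (s : tsort) : Type :=
  match s with St => Mt | Sb => Mb end.

Record structure (L : language) (Mt Mb : Type) : Type := Structure {
  inh_t : inhabited Mt;
  inh_b : inhabited Mb;
  finterp : forall f : fsym L,
    (forall i : 'I_(farity f), dom Mt Mb (fdom i)) -> dom Mt Mb (fcod f);
  rinterp : forall r : rsym L,
    (forall i : 'I_(rarity r), dom Mt Mb (rdom i)) -> Prop
}.

Definition valuation (Mt Mb : Type) : Type := ((nat -> Mt) * (nat -> Mb))%type.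

Definition lookup (Mt Mb : Type) (v : valuation Mt Mb) (s : tsort) :
    nat -> dom Mt Mb s :=
  match s with St => v.1 | Sb => v.2 end.

Definition upd (Mt Mb : Type) (v : valuation Mt Mb) (s : tsort) (n : nat) :
    dom Mt Mb s -> valuation Mt Mb :=
  match s with
  | St => fun a => (fun m => if m == n then a else v.1 m, v.2)
  | Sb => fun a => (v.1, fun m => if m == n then a else v.2 m)
  end.

Section Semantics.
Variables (L : language) (Mt Mb : Type) (M : structure L Mt Mb).

Fixpoint teval (v : valuation Mt Mb) (s : tsort) (t : term L s) :
    dom Mt Mb s :=
  match t with
  | Var s n => lookup v s n
  | App f u => finterp M (fun i => teval v (u i))
  end.

Fixpoint sat (v : valuation Mt Mb) (f : formula L) : Prop :=
  match f with
  | Fbot => False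
  | Feq _ t u => teval v t = teval v u
  | Frel r u => rinterp M (fun i => teval v (u i))
  | Fimp g h => sat v g -> sat v h
  | Fall s n g => forall a : dom Mt Mb s, sat (upd v n a) g
  end.

(** The set defined by [f] in the point variable number 0, the other variables
    being interpreted as parameters given by [v]. *)
Definition solset (f : formula L) (v : valuation Mt Mb) : set Mt :=
  [set a | sat (@upd Mt Mb v St 0 a) f].

Definition definable (X : set Mt) : Prop := exists f v, X = solset f v.

(** Definability of the subset [{(a, b) | R a b}] of [U * U]. *)
Definition definable_rel_on (U : set Mt) (R : Mt -> Mt -> Prop) : Prop :=
  exists f v, forall a b, U a -> U b ->
    (R a b <-> sat (@upd Mt Mb (@upd Mt Mb v St 0 a) St 1 b) f).

(** Every 1-type, in either sort, over a finite set of parameters is realized.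
    The parameters are the values under [v] of the variables with number less
    than [N] occurring in the type [p]; the variable of the type is the one of
    sort [s] and number [n]. *)
Definition omega_saturated : Prop :=
  forall (s : tsort) (n N : nat) (v : valuation Mt Mb) (p : set (formula L)),
    (forall f s' m, p f -> free s' m f -> m < N) ->
    (forall (k : nat) (F : 'I_k -> formula L), (forall i, p (F i)) ->
       exists a : dom Mt Mb s, forall i, sat (upd v n a) (F i)) ->
    exists a : dom Mt Mb s, forall f, p f -> sat (upd v n a) f.

End Semantics.

Inductive boolean_comb (T : Type) (G : set (set T)) : set T -> Prop :=
| bc_base A : G A -> boolean_comb G A
| bc_compl A : boolean_comb G A -> boolean_comb G (~` A)
| bc_union A B :
    boolean_comb G A -> boolean_comb G B -> boolean_comb G (A `|` B).

Definition succ_of d (W : orderType d) (a b : W) : Prop :=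
  (a < b)%O /\ forall c : W, (c < b)%O -> (c <= a)%O.

Definition is_limit d (W : orderType d) (a : W) : Prop :=
  (exists b : W, (b < a)%O) /\ ~ exists b : W, succ_of b a.

Section Topological.
Variables (L : language) (Mt : topologicalType) (Mb : Type).
Variable M : structure L Mt Mb.

(** [phi] is a formula phi(x, y_1, ..., y_k), where x is the point variable
    number 0 and the y_i are the parameter variables with number less than
    [k]. *)
Definition fo_topological (phi : formula L) (k : nat) : Prop :=
  (forall s n, free s n phi -> (s = St /\ n = 0) \/ (s = Sb /\ n < k)) /\
  basis [set B : set Mt | exists v, B = solset M phi v].

Definition definable_from_open : Prop :=
  forall X : set Mt, definable M X ->
    boolean_comb [set U | definable M U /\ open U] X.

(** [rank_ge a X] is D_M(X) >= a, where the ordinal a is given as an element of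
    a well-ordered type [W], namely as the order type of [{b : W | b < a}]. *)
Inductive rank_ge d (W : orderType d) : W -> set Mt -> Prop :=
| rank_ge_zero a X :
    (forall b : W, (a <= b)%O) -> X !=set0 -> rank_ge a X
| rank_ge_succ a b X Y :
    succ_of a b -> closed Y -> definable M Y -> Y `<=` X ->
    @interior (subspace X) Y = set0 -> rank_ge a Y -> rank_ge b X
| rank_ge_limit a X :
    is_limit a -> (forall b : W, (b < a)%O -> rank_ge b X) -> rank_ge a X.

Definition has_dimension : Prop :=
  forall X : set Mt, closed X -> definable M X ->
    exists d (W : orderType d) (a : W),
      well_order (fun x y : W => (x <= y)%O) /\ ~ rank_ge a X.

Definition one_dimensional : Prop :=
  rank_ge (1 : nat) [set: Mt] /\ ~ rank_ge (2 : nat) [set: Mt].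

Definition clopen_partition (X : set Mt) (d : nat) (P : 'I_d -> set Mt) : Prop :=
  [/\ \bigcup_i P i = X, trivIset setT P &
      forall i, [/\ P i !=set0, definable M (P i) & @clopen (subspace X) (P i)]].

Definition has_clopen_partition (X : set Mt) (d : nat) : Prop :=
  exists P : 'I_d -> set Mt, clopen_partition X P.

(** [comp_number X d] is d_M(X) = d; d_M(X) is infinite when there is no such
    [d]. *)
Definition comp_number (X : set Mt) (d : nat) : Prop :=
  has_clopen_partition X d /\
  forall e, has_clopen_partition X e -> e <= d.

Definition def_connected (X : set Mt) : Prop := ~ has_clopen_partition X 2.

Definition def_component (X C : set Mt) : Prop :=
  exists (d : nat) (P : 'I_d -> set Mt),
    [/\ comp_number X d, clopen_partition X P & exists i, C = P i].

Definition ttt (phi : formula L) (k : nat) : Prop :=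
  [/\ fo_topological phi k, hausdorff_space Mt, definable_from_open,
      has_dimension &
      forall X : set Mt, definable M X -> exists d, comp_number X d].

(** Endpoints in [U] or infinite; [None] is -oo as a lower endpoint and +oo as
    an upper one. *)
Definition endpoint (U : set Mt) (e : option Mt) : Prop :=
  if e is Some a then U a else True.

Definition ointerval (U : set Mt) (lt : Mt -> Mt -> Prop) (lo hi : option Mt) :
    set Mt :=
  [set x | [/\ U x, (if lo is Some a then lt a x else True) &
               (if hi is Some b then lt x b else True)]].

Definition dense_linear_order_on (U : set Mt) (lt : Mt -> Mt -> Prop) : Prop :=
  [/\ forall x, U x -> ~ lt x x,
      forall x y z, U x -> U y -> U z -> lt x y -> lt y z -> lt x z,
      forall x y, U x -> U y -> [\/ lt x y, x = y | lt y x] &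
      forall x y, U x -> U y -> lt x y -> exists z, [/\ U z, lt x z & lt z y]].

Definition order_topology_on (U : set Mt) (lt : Mt -> Mt -> Prop) : Prop :=
  forall V : set Mt, V `<=` U ->
    (@open (subspace U) V <->
     forall x, V x -> exists lo hi,
       [/\ endpoint U lo, endpoint U hi, ointerval U lt lo hi x &
           ointerval U lt lo hi `<=` V]).

Definition points_and_intervals (U : set Mt) (lt : Mt -> Mt -> Prop)
    (S : set Mt) : Prop :=
  exists (F : set Mt) (n : nat) (lo hi : 'I_n -> option Mt),
    [/\ finite_set F,
        forall i, endpoint U (lo i) /\ endpoint U (hi i) &
        S = F `|` \bigcup_i ointerval U lt (lo i) (hi i)].

Definition o_minimal (U : set Mt) : Prop :=
  [/\ definable M U, open U &
      exists lt : Mt -> Mt -> Prop,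
        [/\ definable_rel_on M U lt, dense_linear_order_on U lt,
            order_topology_on U lt &
            forall S : set Mt, definable M S -> S `<=` U ->
              points_and_intervals U lt S]].

End Topological.

(* Main.v *)
(** Since [M] has dimension 1, closed definable sets without interior are
    finite, so by (A) every definable set has finite boundary.  By saturation,
    finitely many formulas define, for all points [x] at once, clopen partitions
    of [M \ {x}].  Fix a point [a] and let [x < y] mean that one of these
    partitions separates [a] from [y]; this is a definable tree order in which
    the set of points below any given point is a chain.  The points of [M] that
    are strictly above [x] and not above [y] form an open set [fat x y] with
    boundary contained in [{x, y}], and when it is a chain it is connected,
      since
    each of its points separates [a] from [y].  If the points [z] without a
    neighbourhood of this kind were infinitely many, they would contain an open
    set [O] in which all chains below points are finite but, as no point is
    maximal in [O], arbitrarily long; this contradicts saturation.  Removing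
    these finitely many points, comparability with a fixed point is a clopen
    condition, so each component is a chain, and finiteness of boundaries gives
    o-minimality. *)

From Stdlib Require List.
Require Import Defs.
From mathcomp Require Import all_boot all_order.
From mathcomp Require Import boolp classical_sets.
From mathcomp Require Import cardinality topology.

Set Implicit Arguments.
Unset Strict Implicit.
Unset Printing Implicit Defensive.

Local Open Scope classical_set_scope.

(** * Formulas and definable predicates of valuations *)

Section Valuations.
Variables (L : language) (Mt Mb : Type).
Implicit Types v w : valuation Mt Mb.

Lemma valuation_eq v w :
  (forall s n, lookup v s n = lookup w s n) -> v = w.
Proof.
case: v w => [v1 v2] [w1 w2] H; congr pair; apply/funext => n.
  exact: (H St).
exact: (H Sb).
Qed.

Lemma lookup_upd v s n a : lookup (@upd _ _ v s n a) s n = a.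
Proof. by case: s a => a /=; rewrite eqxx. Qed.

Lemma lookup_upd_other v s n a s' m : ~ (s = s' /\ n = m) ->
  lookup (@upd _ _ v s n a) s' m = lookup v s' m.
Proof.
by case: s a => a; case: s' => //= H; case: eqP => // E; case: H.
Qed.

(** Pulls a valuation back along a renaming; by [sat_ren] this is the semantic side of [fren]. *)
Definition vren (r : tsort -> nat -> nat) v : valuation Mt Mb :=
  (fun n => v.1 (r St n), fun n => v.2 (r Sb n)).

Lemma lookup_vren r v s n : lookup (vren r v) s n = lookup v s (r s n).
Proof. by case: s. Qed.

Lemma vren_upd r v s n a : injective (r s) ->
  vren r (@upd _ _ v s (r s n) a) = @upd _ _ (vren r v) s n a.
Proof.
move=> inj; apply: valuation_eq => s' m; rewrite lookup_vren.
have [[<- <-]|H] := pselect (s = s' /\ n = m); first by rewrite !lookup_upd.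
rewrite !lookup_upd_other ?lookup_vren// => -[E]; move: H; rewrite -E.
by move=> H /inj E'; exact: H.
Qed.

Fixpoint tren (r : tsort -> nat -> nat) s (t : term L s) : term L s :=
  match t with
  | Var s n => Var L s (r s n)
  | App f u => App (fun i => tren r (u i))
  end.

Fixpoint fren (r : tsort -> nat -> nat) (f : formula L) : formula L :=
  match f with
  | Fbot => Fbot L
  | Feq _ t u => Feq (tren r t) (tren r u)
  | Frel p u => Frel (fun i => tren r (u i))
  | Fimp g h => Fimp (fren r g) (fren r h)
  | Fall s n g => Fall s (r s n) (fren r g)
  end.

Lemma tfree_bound s (t : term L s) :
  exists N, forall s' n, tfree s' n t -> n < N.
Proof.
elim: t => [s1 n|f u IH] /=; first by exists n.+1 => s' m [_ ->].
have [N HN] := choice IH.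
exists (\max_i N i) => s' n [i /HN ltn].
exact: leq_trans ltn (leq_bigmax i).
Qed.

Lemma free_bound (f : formula L) :
  exists N, forall s n, free s n f -> n < N.
Proof.
elim: f => [|s t u|r u|g [N HN] h [K HK]|s m g [N HN]] /=.
- by exists 0.
- have [N HN] := tfree_bound t; have [K HK] := tfree_bound u.
  exists (maxn N K) => s' n [/HN|/HK] lt; rewrite leq_max lt ?orbT//.
- have [N HN] := choice (fun i => tfree_bound (u i)).
  exists (\max_i N i) => s' n [i /HN ltn].
  exact: leq_trans ltn (leq_bigmax i).
- exists (maxn N K) => s' n [/HN|/HK] lt; rewrite leq_max lt ?orbT//.
- by exists N => s' n [/HN].
Qed.

Variable M : structure L Mt Mb.

Lemma teval_agree v w s (t : term L s) :
  (forall s' n, tfree s' n t -> lookup v s' n = lookup w s' n) ->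
  teval M v t = teval M w t.
Proof.
elim: t => [s1 n|f u IH] /= H; first exact: H.
congr (finterp M _); apply: functional_extensionality_dep => i.
by apply: IH => s' n fr; apply: H; exists i.
Qed.

Lemma sat_agree (f : formula L) v w :
  (forall s n, free s n f -> lookup v s n = lookup w s n) ->
  sat M v f <-> sat M w f.
Proof.
elim: f v w => [|s t u|r u|g IHg h IHh|s n g IH] v w /= H.
- by [].
- rewrite (@teval_agree v w _ t); last by move=> *; apply: H; left.
  by rewrite (@teval_agree v w _ u)// => *; apply: H; right.
- rewrite (_ : (fun i => teval M v (u i)) = fun i => teval M w (u i)) //.
  apply: functional_extensionality_dep => i.
  by apply: teval_agree => s' n fr; apply: H; exists i.
- rewrite (IHg v w); last by move=> *; apply: H; left.
  by rewrite (IHh v w)// => *; apply: H; right.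
- have E a : sat M (@upd _ _ v s n a) g <-> sat M (@upd _ _ w s n a) g.
    apply: IH => s' m fr.
    have [[<- <-]|Hn] := pselect (s = s' /\ n = m);
      first by rewrite !lookup_upd.
    rewrite !lookup_upd_other//; exact: H.
  split; move=> H' a; apply/E; exact: H'.
Qed.

Lemma teval_ren r v s (t : term L s) :
  teval M v (tren r t) = teval M (vren r v) t.
Proof.
elim: t => [s1 n|f u IH] /=; first by rewrite lookup_vren.
by congr (finterp M _); apply: functional_extensionality_dep => i.
Qed.

(** In the quantifier case injectivity of [r] makes updates commute with the pullback ([vren_upd]),
    so that no variable is captured. *)
Lemma sat_ren r v (f : formula L) : (forall s, injective (r s)) ->
  sat M v (fren r f) <-> sat M (vren r v) f.
Proof.
move=> inj; elim: f v => [|s t u|p u|g IHg h IHh|s n g IH] v //=.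
- by rewrite !teval_ren.
- rewrite (_ : (fun i => teval M v (tren r (u i))) =
    fun i => teval M (vren r v) (u i)) //.
  by apply: functional_extensionality_dep => i; exact: teval_ren.
- by rewrite IHg IHh.
- by split; move=> H a; have := H a; rewrite IH vren_upd.
Qed.

End Valuations.

Section Definability.
Variables (L : language) (Mt Mb : Type) (M : structure L Mt Mb).
Notation val := (valuation Mt Mb).
Implicit Types (P Q : val -> Prop) (v w : val).

(** Definability without parameters is treated semantically, so that closure properties take the
    place of explicit formulas. *)
Definition zero_def P := exists f : formula L, forall v, P v <-> sat M v f.

Definition supported N P := forall v w,
  (forall s n, n < N -> lookup v s n = lookup w s n) -> P v <-> P w.

Lemma zero_def_supported P : zero_def P -> exists N, supported N P.
Proof.
move=> [f Hf]; have [N HN] := free_bound f; exists N => v w H.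
by rewrite !Hf; apply: sat_agree => s n /HN; exact: H.
Qed.

Lemma zero_def_ext P Q : (forall v, P v <-> Q v) -> zero_def P -> zero_def Q.
Proof. by move=> E [f Hf]; exists f => v; rewrite -E. Qed.

Lemma zero_def_sat (f : formula L) : zero_def (fun v => sat M v f).
Proof. by exists f. Qed.

Lemma zero_def_imp P Q :
  zero_def P -> zero_def Q -> zero_def (fun v => P v -> Q v).
Proof. by move=> [f Hf] [g Hg]; exists (Fimp f g) => v /=; rewrite Hf Hg. Qed.

Lemma zero_def_cst (p : Prop) : zero_def (fun=> p).
Proof.
have [pT|pF] := pselect p; last by exists (Fbot L) => v; split.
by exists (Fimp (Fbot L) (Fbot L)) => v /=; split.
Qed.

Lemma zero_def_not P : zero_def P -> zero_def (fun v => ~ P v).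
Proof. by move=> HP; apply: zero_def_imp => //; exact: zero_def_cst. Qed.

Lemma zero_def_and P Q :
  zero_def P -> zero_def Q -> zero_def (fun v => P v /\ Q v).
Proof.
move=> HP HQ.
apply: (@zero_def_ext (fun v => ~ (P v -> ~ Q v))).
  by move=> v; rewrite not_implyE notE.
by apply: zero_def_not; apply: zero_def_imp => //; exact: zero_def_not.
Qed.

Lemma zero_def_iff P Q :
  zero_def P -> zero_def Q -> zero_def (fun v => P v <-> Q v).
Proof. by move=> HP HQ; apply: zero_def_and; apply: zero_def_imp. Qed.

Lemma zero_def_all s n P :
  zero_def P -> zero_def (fun v => forall a, P (@upd _ _ v s n a)).
Proof.
by move=> [f Hf]; exists (Fall s n f) => v /=; split=> H a; apply/Hf.
Qed.

Lemma zero_def_ex s n P :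
  zero_def P -> zero_def (fun v => exists a, P (@upd _ _ v s n a)).
Proof.
move=> HP.
apply: (@zero_def_ext (fun v => ~ forall a, ~ P (@upd _ _ v s n a))).
  by move=> v; split=> [/existsNP[a /contrapT]|[a Pa] /(_ a)]; [exists a|].
by apply/zero_def_not/(@zero_def_all s n (fun v => ~ P v))/zero_def_not.
Qed.

Lemma zero_def_eq s n m : zero_def (fun v => lookup v s n = lookup v s m).
Proof. by exists (Feq (Var L s n) (Var L s m)). Qed.

(** A whole block of existential quantifiers at once. It later binds the parameters of a basis set
    and those of a separating formula. *)
Lemma zero_def_ex_list (l : list (tsort * nat)) P : zero_def P ->
  zero_def (fun v => exists w,
    (forall s n, ~ List.In (s, n) l -> lookup w s n = lookup v s n) /\ P w).
Proof.
elim: l P => [|[s0 n0] l IH] P HP.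
  apply: zero_def_ext HP => v; split=> [Pv|[w [H Pw]]]; first by exists v.
  have <- // : w = v by apply: valuation_eq => s n; exact: H.
apply: zero_def_ext (zero_def_ex s0 n0 (IH _ HP)) => v.
split=> [[a [w [H Pw]]]|[w [H Pw]]].
  exists w; split=> // s n /= nin; rewrite H; last by move=> ?; apply: nin;
    right.
  by rewrite lookup_upd_other// => -[E1 E2]; apply: nin; left; rewrite E1 E2.
exists (lookup w s0 n0), w; split=> // s n nin.
have [[<- <-]|Hn] := pselect (s0 = s /\ n0 = n); first by rewrite lookup_upd.
by rewrite lookup_upd_other// H//= => -[[? ?]|]//; apply: Hn.
Qed.

Lemma zero_def_ren_inj r P : (forall s, injective (r s)) ->
  zero_def P -> zero_def (fun v => P (vren r v)).
Proof.
by move=> inj [f Hf]; exists (fren r f) => v; rewrite Hf sat_ren.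
Qed.

(** A renaming that is not injective could capture bound variables; the
    variables are first moved to fresh positions, which are then bound
    existentially and set equal to the desired ones. *)
Lemma zero_def_ren r P : zero_def P -> zero_def (fun v => P (vren r v)).
Proof.
move=> HP; have [N HN] := zero_def_supported HP.
pose K := (\max_(i < N) maxn (r St i) (r Sb i)).+1.
have ltK s i : i < N -> r s i < K.
  move=> ltN; rewrite ltnS.
  apply: leq_trans (leq_bigmax (Ordinal ltN)) => /=.
  by case: s; rewrite leq_max leqnn ?orbT.
(* Indices below [j] are already at their targets, the others still at fresh positions shifted by
   [K]. The induction starts from the pure shift, which is injective, and moves one index of both
   sorts at a time. *)
pose rj j s i := if i < j then r s i else (i + K)%N.
suff H j : j <= N -> zero_def (fun v => P (vren (rj j) v)).
  apply: zero_def_ext (H N (leqnn N)) => v; apply: HN => s n ltn.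
  by rewrite !lookup_vren /rj ltn.
elim: j => [_|j IH ltN].
  by apply: zero_def_ren_inj HP => s i i' /addIn.
have := zero_def_ex St (j + K) (zero_def_ex Sb (j + K)
  (zero_def_and (zero_def_and (zero_def_eq St (j + K) (r St j))
                   (zero_def_eq Sb (j + K) (r Sb j))) (IH (ltnW ltN)))).
apply: zero_def_ext => v.
have neqF s : (r s j == (j + K)%N) = false.
  by apply/eqP => E; have := ltK s _ ltN; rewrite E ltnNge leq_addl.
have E a b : lookup v St (r St j) = a -> lookup v Sb (r Sb j) = b ->
    P (vren (rj j) (@upd _ _ (@upd _ _ v St (j + K) a) Sb (j + K) b)) <->
    P (vren (rj j.+1) v).
  move=> Ea Eb; apply: HN => s i ltiN; rewrite !lookup_vren /rj ltnS.
  case: (ltngtP i j) => [lt|gt|->].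
  - have ne : j + K <> r s i.
      by move=> E; have := ltK s _ ltiN; rewrite -E ltnNge leq_addl.
    by rewrite !lookup_upd_other// => -[].
  - have ne : j + K <> i + K by move/addIn => E; rewrite E ltnn in gt.
    by rewrite !lookup_upd_other// => -[].
  - by case: s => /=; rewrite eqxx.
split=> [[a [b [[E1 E2] H]]]|H].
  move: E1 E2; rewrite /= !eqxx !neqF => E1 E2.
  exact: (proj1 (E a b (esym E1) (esym E2)) H).
exists (v.1 (r St j)), (v.2 (r Sb j)); split; last exact/E.
by rewrite /= !eqxx !neqF.
Qed.

End Definability.

(** * Predicates definable with parameters *)

Section Parametric.
Variables (L : language) (Mt Mb : Type) (M : structure L Mt Mb).
Notation val := (valuation Mt Mb).

Definition interleave (T : Type) (a b : nat -> T) : nat -> T :=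
  fun n => if odd n then b n./2 else a n./2.

Lemma interleave_even T (a b : nat -> T) n : interleave a b n.*2 = a n.
Proof. by rewrite /interleave odd_double doubleK. Qed.

Lemma interleave_odd T (a b : nat -> T) n : interleave a b n.*2.+1 = b n.
Proof. by rewrite /interleave /= odd_double /= uphalf_double. Qed.

Lemma even_or_odd n : exists m, n = m.*2 \/ n = m.*2.+1.
Proof.
exists n./2; rewrite -{1 3}(odd_double_half n).
by case: (odd n); [right|left].
Qed.

(** The even variables of a formula carry the arguments, the odd ones the
    point parameters. *)
Definition vjoin (e : nat -> Mt) (p : val) : val := (interleave e p.1, p.2).

(** Arguments are addressed by position and parameters are hidden in [p], so that logical
    combinations can be formed without tracking variable names. *)
Definition pdef (P : (nat -> Mt) -> Prop) := exists (Q : val -> Prop) (p : val),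
  zero_def M Q /\ forall e, P e <-> Q (vjoin e p).

Lemma pdef_ext (P Q : (nat -> Mt) -> Prop) :
  (forall e, P e <-> Q e) -> pdef P -> pdef Q.
Proof.
by move=> E [R [p [HR H]]]; exists R, p; split=> // e; rewrite -E.
Qed.

Lemma pdef_common (P P' : (nat -> Mt) -> Prop) : pdef P -> pdef P' ->
  exists (Q Q' : val -> Prop) (p : val), [/\ zero_def M Q, zero_def M Q',
    forall e, P e <-> Q (vjoin e p) & forall e, P' e <-> Q' (vjoin e p)].
Proof.
move=> [Q [p [HQ H]]] [Q' [p' [HQ' H']]].
(* The two families of parameters are interleaved in each sort: parameter [m] of predicate number
   [i] becomes common parameter [2m + i]. *)
pose r i s n := if s is St then interleave double (fun m =>
  ((m.*2 + i).*2).+1)%N n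
  else (n.*2 + i)%N.
exists (fun v => Q (vren (r 0) v)), (fun v => Q' (vren (r 1) v)).
exists (interleave p.1 p'.1, interleave p.2 p'.2); split;
  try exact: zero_def_ren.
- move=> e; rewrite H; apply/propeqP; congr Q; congr pair; apply/funext => n /=.
    have [m [->|->]] := even_or_odd n.
      by rewrite !interleave_even.
    by rewrite !interleave_odd addn0 interleave_even.
  by rewrite addn0 interleave_even.
- move=> e; rewrite H'; apply/propeqP; congr Q'; congr pair;
    apply/funext => n /=.
    have [m [->|->]] := even_or_odd n.
      by rewrite !interleave_even.
    by rewrite !interleave_odd addn1 interleave_odd.
  by rewrite addn1 interleave_odd.
Qed.

Lemma pdef_not P : pdef P -> pdef (fun e => ~ P e).
Proof.
move=> [Q [p [HQ H]]]; exists (fun v => ~ Q v), p.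
by split; [exact: zero_def_not|move=> e; rewrite H].
Qed.

Lemma pdef_imp P P' : pdef P -> pdef P' -> pdef (fun e => P e -> P' e).
Proof.
move=> HP /(pdef_common HP)[Q [Q' [p [HQ HQ' H H']]]].
exists (fun v => Q v -> Q' v), p; split; first exact: zero_def_imp.
by move=> e; rewrite H H'.
Qed.

Lemma pdef_and P P' : pdef P -> pdef P' -> pdef (fun e => P e /\ P' e).
Proof.
move=> HP /(pdef_common HP)[Q [Q' [p [HQ HQ' H H']]]].
exists (fun v => Q v /\ Q' v), p; split; first exact: zero_def_and.
by move=> e; rewrite H H'.
Qed.

Lemma pdef_or P P' : pdef P -> pdef P' -> pdef (fun e => P e \/ P' e).
Proof.
move=> HP HP'; apply: (@pdef_ext (fun e => ~ P e -> P' e)).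
  move=> e; split=> [H|[]//].
  by have [|/H] := pselect (P e); [left|right].
exact: pdef_imp (pdef_not HP) HP'.
Qed.

Lemma pdef_cst (q : Prop) : inhabited Mt -> inhabited Mb -> pdef (fun=> q).
Proof.
move=> [a] [b]; exists (fun=> q), (fun=> a, fun=> b).
by split; first exact: zero_def_cst.
Qed.

Definition pt (e : nat -> Mt) (x : nat + Mt) : Mt :=
  match x with inl i => e i | inr c => c end.

Lemma pdef_subst P (t : nat -> nat + Mt) :
  pdef P -> pdef (fun e => P (fun n => pt e (t n))).
Proof.
move=> [Q [p [HQ H]]].
pose r s n := if s is St then
    interleave (fun m => if t m is inl i then i.*2 else (m.*2.+1).*2.+1)
       (fun m => (m.*2).*2.+1) n
  else n.
(* The constants join the parameters. At positions replaced by a variable, [c] is never read and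
   [p.1 0] is a filler. *)
pose c n := if t n is inr c then c else p.1 0.
exists (fun v => Q (vren r v)), (interleave p.1 c, p.2).
split; first exact: zero_def_ren.
move=> e; rewrite H; apply/propeqP; congr Q; congr pair; apply/funext => n /=.
have [m [->|->]] := even_or_odd n.
  rewrite !interleave_even; case E: (t m) => [i|d] /=;
    first by rewrite interleave_even.
  by rewrite !interleave_odd /c E.
by rewrite !interleave_odd !interleave_even.
Qed.

(** Quantifiers follow the de Bruijn convention: the bound point is entry 0 and the other entries
    are shifted by one. *)
Lemma pdef_all (Q : Mt -> (nat -> Mt) -> Prop) :
  pdef (fun e => Q (e 0) (fun n => e n.+1)) ->
  pdef (fun e => forall a, Q a e).
Proof.
move=> [R [p [HR H]]].
(* Moving the point parameters up by one slot frees variable 1, which receives the bound point. *)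
pose r s n := if s is St then
    interleave (fun m => if m is k.+1 then k.*2 else 1) (fun m => m.+1.*2.+1) n
  else n.
exists (fun v => forall a, R (vren r (@upd _ _ v St 1 a))).
exists (fun n => p.1 n.-1, p.2); split.
  by apply: (@zero_def_all _ _ _ _ St 1 (fun v => R (vren r v)));
    exact: zero_def_ren.
move=> e.
have E a : Q a e <-> R (vren r (@upd _ _ (vjoin e (fun n =>
  p.1 n.-1, p.2)) St 1 a)).
  pose e' n := if n is k.+1 then e k else a.
  apply: (iff_trans (H e')).
  apply/propeqP; congr R; congr pair; apply/funext => n /=.
  have [m [->|->]] := even_or_odd n.
    rewrite !interleave_even; case: m => [|m]; first by rewrite eqxx.
    by rewrite interleave_even; case: eqP => // E; have := odd_double m;
      rewrite E.
  by rewrite !interleave_odd.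
by split; move=> K a; apply/E.
Qed.

Lemma pdef_ex (Q : Mt -> (nat -> Mt) -> Prop) :
  pdef (fun e => Q (e 0) (fun n => e n.+1)) ->
  pdef (fun e => exists a, Q a e).
Proof.
move=> HQ; apply: (@pdef_ext (fun e => ~ forall a, ~ Q a e)).
  by move=> e; split=> [/existsNP[a /contrapT]|[a Qa] /(_ a)]; [exists a|].
by apply/pdef_not/(@pdef_all (fun a e => ~ Q a e))/pdef_not.
Qed.

Definition isterm (t : (nat -> Mt) -> Mt) := exists x, t = pt^~ x.

Lemma isterm_var i : isterm (fun e => e i).
Proof. by exists (inl i). Qed.

Lemma isterm_cst c : isterm (fun=> c).
Proof. by exists (inr c). Qed.

Lemma pdef_app1 (R : Mt -> Prop) t : pdef (fun e => R (e 0)) ->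
  isterm t -> pdef (fun e => R (t e)).
Proof. by move=> HR [x ->]; exact: (pdef_subst (fun=> x) HR). Qed.

Lemma pdef_app2 (R : Mt -> Mt -> Prop) t u : pdef (fun e => R (e 0) (e 1)) ->
  isterm t -> isterm u -> pdef (fun e => R (t e) (u e)).
Proof.
move=> HR [x ->] [y ->].
exact: (pdef_subst (fun n => if n is 0 then x else y) HR).
Qed.

Lemma pdef_app3 (R : Mt -> Mt -> Mt -> Prop) t u w :
  pdef (fun e => R (e 0) (e 1) (e 2)) ->
  isterm t -> isterm u -> isterm w -> pdef (fun e => R (t e) (u e) (w e)).
Proof.
move=> HR [x ->] [y ->] [z ->].
exact: (pdef_subst (fun n => match n with 0 => x | 1 => y | _ => z end) HR).
Qed.

Lemma pdef_eq t u : isterm t -> isterm u -> pdef (fun e => t e = u e).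
Proof.
apply: (@pdef_app2 (fun x y => x = y)).
case: (inh_t M) => a; case: (inh_b M) => b.
exists (fun v => lookup v St 0 = lookup v St 2), (fun=> a, fun=> b).
by split; first exact: zero_def_eq.
Qed.

Lemma pdef_zero_def (Q : val -> Prop) : zero_def M Q ->
  forall b, pdef (fun e => Q (e, b)).
Proof.
move=> HQ b; case: (inh_t M) => a.
exists (fun v => Q (vren (fun s n => if s is St then n.*2 else n) v)).
exists (fun=> a, b); split; first exact: zero_def_ren.
move=> e; apply/propeqP; congr Q; congr pair; apply/funext => n /=.
by rewrite interleave_even.
Qed.

Lemma pdef_definable (X : set Mt) : definable M X <-> pdef (fun e => X (e 0)).
Proof.
split=> [[f [p ->]]|[Q [p [[f Hf] H]]]].
  pose r s n := if s is St then (if n is k.+1 then k.*2.+1 else 0) else n.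
  exists (fun v => sat M (vren r v) f), (fun n => p.1 n.+1, p.2).
  split; first exact: (zero_def_ren r (zero_def_sat M f)).
  move=> e; apply/propeqP; congr (sat M _ f).
  apply: valuation_eq => -[] //= -[|n] /=.
    by rewrite (@interleave_even _ _ _ 0).
  by rewrite interleave_odd.
(* The predicate depends on entry 0 only, so all arguments may be read from variable 0; the
   parameters occupy the variables from 1 on. *)
pose r s n := if s is St then interleave (fun=> 0) (fun m => m.+1) n else n.
have [g Hg] := zero_def_ren r (zero_def_sat M f).
exists g, (fun n => p.1 n.-1, p.2); apply/seteqP.
suff E a : X a <-> solset M g (fun n => p.1 n.-1, p.2) a.
  by split=> a /E.
rewrite /solset/= -Hg (H (fun=> a)) Hf; apply/propeqP; congr (sat M _ f).
apply: valuation_eq => -[] //= n; have [m [->|->]] := even_or_odd n.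
  by rewrite !interleave_even.
by rewrite !interleave_odd.
Qed.

End Parametric.

(** * Definability of the interior; saturation *)

Lemma variable_block s lo k : exists l : list (tsort * nat),
  forall s' n, List.In (s', n) l <-> s' = s /\ lo <= n < lo + k.
Proof.
elim: k => [|k [l Hl]].
  exists nil => s' n; split=> // -[_] /andP[/leq_ltn_trans H /H].
  by rewrite addn0 ltnn.
exists ((s, (lo + k)%N) :: l) => s' n /=; rewrite Hl addnS ltnS.
split=> [[[-> <-]|[-> /andP[-> /ltnW ->]]]|[-> /andP[le]]] //.
  by rewrite leq_addr leqnn.
by rewrite leq_eqVlt => /orP[/eqP ->|lt]; [left|right; rewrite le lt].
Qed.

Section Topology.
Variables (L : language) (Mt : topologicalType) (Mb : Type).
Variables (M : structure L Mt Mb) (phi : formula L) (k : nat).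
Hypothesis fo : fo_topological M phi k.
Notation val := (valuation Mt Mb).

Let ball (b : nat -> Mb) z := sat M (fun=> z, b) phi.

Lemma ball_agree b b' z :
  (forall j, j < k -> b j = b' j) -> ball b z <-> ball b' z.
Proof.
move=> E; apply: sat_agree => s n /(proj1 fo)[[-> _]//|[-> lt]] /=.
exact: E.
Qed.

Lemma solset_ball (w : val) : solset M phi w = ball w.2.
Proof.
apply/seteqP; suff E z : solset M phi w z <-> ball w.2 z by split=> z /E.
by apply: sat_agree => s n /(proj1 fo)[[-> ->]|[-> lt]].
Qed.

Lemma nbhs_ball x (A : set Mt) :
  nbhs x A <-> exists b, ball b x /\ forall z, ball b z -> A z.
Proof.
split=> [/(proj2 (proj2 fo) x)[B [[w ->] Bx] BA]|[b [bx bA]]].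
  by exists w.2; rewrite -solset_ball; split=> // z; exact: BA.
apply: (@filterS _ _ _ (ball b)) => //.
apply: open_nbhs_nbhs; split=> //; apply: (proj1 (proj2 fo)).
case: (inh_t M) => a; by exists (fun=> a, b); rewrite solset_ball.
Qed.

(** A point is interior when some basis set around it is contained in the set. All basis sets come
    from the one formula [phi], so this is a quantification over [k] parameters. *)
Lemma zero_def_interior (P : val -> Prop) n m : zero_def M P ->
  zero_def M (fun v => interior [set z | P (@upd _ _ v St n z)] (v.1 m)).
Proof.
move=> HP; have [N HN] := zero_def_supported HP.
(* The parameters of the basis set sit at positions [N] and above, outside the support of [P], so
   binding them leaves [P] unaffected. *)
pose PH i (v : val) := ball (fun j => v.2 (N + j)%N) (v.1 i).
have HPH i : zero_def M (PH i).
  exact: (zero_def_ren (fun s j => if s is St then i else N + j)%N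
    (zero_def_sat M phi)).
have [l Hl] := variable_block Sb N k.
have := zero_def_ex_list l (zero_def_and (HPH m)
  (@zero_def_all _ _ _ _ St n _ (zero_def_imp (HPH n) HP))).
apply: zero_def_ext => v; rewrite /interior /= nbhs_ball.
have HPw (w : val) z :
    (forall s n, ~ List.In (s, n) l -> lookup w s n = lookup v s n) ->
    P (@upd _ _ w St n z) <-> P (@upd _ _ v St n z).
  move=> E; apply: HN => s i ltN.
  have [[<- <-]|ne] := pselect (St = s /\ n = i); first by rewrite !lookup_upd.
  rewrite !lookup_upd_other// E// Hl => -[_] /andP[le _].
  by rewrite ltnNge le in ltN.
split=> [[w [E [H1 H2]]]|[b [bx bA]]].
  exists (fun j => w.2 (N + j)%N); split.
    have := E St m; rewrite /= => <- //.
    by rewrite Hl => -[].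
  move=> z Hz; apply/(HPw _ _ E); apply: H2.
  by rewrite /PH /= eqxx.
pose w : val := (v.1, fun j => if N <= j < N + k then b (j - N)%N else v.2 j).
have Ew j : j < k -> w.2 (N + j)%N = b j.
  by move=> lt; rewrite /= leq_addr ltn_add2l lt addKn.
have E s i : ~ List.In (s, i) l -> lookup w s i = lookup v s i.
  rewrite Hl; case: s => //= ni; case: ifP => // H; by case: ni.
exists w; split=> //; split; first exact/(ball_agree _ Ew).
move=> z; rewrite /PH /= eqxx => /(ball_agree _ Ew) bz.
by apply/(HPw _ _ E); exact: bA.
Qed.

Lemma pdef_interior (Q : Mt -> (nat -> Mt) -> Prop) t :
  pdef M (fun e => Q (e 0) (fun n => e n.+1)) -> isterm t ->
  pdef M (fun e => interior (Q^~ e) (t e)).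
Proof.
move=> [R [p [HR H]]] [x ->].
suff K : pdef M (fun e => interior (Q^~ (fun n => e n.+1)) (e 0)).
  exact: (pdef_subst (fun n => if n is i.+1 then inl i else x) K).
pose r s n := if s is St then
    interleave (fun m => if m is i.+1 then i.+1.*2 else 1) (fun m =>
      m.+1.*2.+1) n
  else n.
exists (fun v => interior [set z | R (vren r (@upd _ _ v St 1 z))] (v.1 0)).
exists (fun n => p.1 n.-1, p.2); split.
  exact: (@zero_def_interior (fun v => R (vren r v)) 1 0 (zero_def_ren r HR)).
move=> e.
rewrite (_ : Q^~ (fun n => e n.+1) =
  [set z | R (vren r (@upd _ _ (vjoin e (fun n => p.1 n.-1, p.2)) St 1 z))]).
  by rewrite /vjoin /= (@interleave_even _ _ _ 0).
apply/funext => z; apply/propext.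
apply: (iff_trans (H (fun n => if n is k.+1 then e k.+1 else z))).
apply/propeqP; congr R; congr pair; apply/funext => n /=.
have [j [->|->]] := even_or_odd n.
  rewrite !interleave_even; case: j => [|j]; first by rewrite eqxx.
  by rewrite interleave_even.
by rewrite !interleave_odd.
Qed.

Lemma definable_interior (X : set Mt) : definable M X ->
  definable M (interior X).
Proof.
move=> /pdef_definable HX; apply/pdef_definable.
apply: (@pdef_interior (fun z _ => X z)); last exact: isterm_var.
exact: HX.
Qed.

End Topology.

Section Saturation.
Variables (L : language) (Mt Mb : Type) (M : structure L Mt Mb).
Notation val := (valuation Mt Mb).
Hypothesis saturated : omega_saturated M.

(** Saturation bounds the variables that occur free, while [supported] only bounds those that
    matter. Quantifying universally over the others removes them, and the truth value is unchanged
    because both sorts are inhabited. *)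
Lemma close_formula (f : formula L) N : supported N (fun v => sat M v f) ->
  exists g, (forall s m, free s m g -> m < N) /\
    forall v : val, sat M v f <-> sat M v g.
Proof.
move=> HN; have [K HK] := free_bound f.
have {HK}: forall s m, free s m f -> m < N + K.
  by move=> s m /HK lt; rewrite (leq_trans lt)// leq_addl.
elim: K f HN => [|K IH] f HN Hf.
  by exists f; split=> // s m /Hf; rewrite addn0.
have E v : sat M v f <-> sat M v (Fall St (N + K) (Fall Sb (N + K) f)).
  have agr a b s n : n < N -> lookup (@upd _ _
      (@upd _ _ v St (N + K) a) Sb (N + K) b) s n = lookup v s n.
    move=> lt; have ne : N + K <> n.
      by move=> E; move: lt; rewrite -E ltnNge leq_addr.
    by rewrite !lookup_upd_other// => -[].
  split=> [Hv a b|].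
    by apply/(HN _ _ (agr a b)).
  case: (inh_t M) => a; case: (inh_b M) => b /(_ a b) Hv.
  by apply/(HN _ _ (agr a b)).
have [|s m /=|g [Hg1 Hg2]] := IH (Fall St (N + K) (Fall Sb (N + K) f)).
- by move=> v w H; rewrite -!E; exact: HN.
- move=> [[/Hf + n1] n2]; rewrite addnS ltnS leq_eqVlt => /orP[/eqP e|//].
  by case: s n1 n2 => n1 n2; [case: n2|case: n1].
- by exists g; split=> // v; rewrite E.
Qed.

Lemma saturated_zero_def (I : Type) (P : I -> val -> Prop) N (v : val) :
  (forall i, zero_def M (P i)) -> (forall i, supported N (P i)) ->
  (forall k (F : 'I_k -> I), exists a : Mt,
     forall j, P (F j) (@upd _ _ v St 0 a)) ->
  exists a : Mt, forall i, P i (@upd _ _ v St 0 a).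
Proof.
move=> HP HN fin.
pose p : set (formula L) := [set g | (forall s m, free s m g -> m < N) /\
  exists i, forall v, P i v <-> sat M v g].
have [||a Ha] := saturated (s := St) (n := 0) (N := N) (v := v) (p := p).
- move=> f s m [H _]; exact: H.
- move=> k F HF; have [G HG] := choice (fun i => proj2 (HF i)).
  have [a Ha] := fin k G; exists a => i.
  by apply/HG; exact: Ha.
exists a => i; have [f Hf] := HP i.
have [|g [Hg1 Hg2]] := @close_formula f N.
  by move=> w w' E; rewrite -!Hf; exact: HN.
apply/Hf/Hg2/Ha; split=> //; exists i => w.
by rewrite Hf Hg2.
Qed.

Variable T : Mt -> Mt -> Prop.

Fixpoint chain_below n z :=
  if n is n'.+1 then exists x, T x z /\ chain_below n' x else True.

(** The existence of a chain of length [n] below [z] is a formula in [z], and it gets stronger as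
    [n] grows. A finite subset of these conditions is therefore realized by any point that satisfies
    its longest one. *)
Lemma saturated_chain : pdef M (fun e => T (e 0) (e 1)) ->
  (forall n, exists z, chain_below n z) ->
  exists z, forall n, chain_below n z.
Proof.
move=> [R [p [HR H]]] Hch.
pose r s n := if s is St then
    interleave (fun m => if m is 0 then 1 else 0) (fun m => m.+2) n else n.
pose T2 (v : val) := R (vren r v).
have HT2 : zero_def M T2 by exact: zero_def_ren.
(* Variables 0 and 1 are used again at every link, so that all the [C n] have a common support bound
   [N], as saturation demands. *)
pose C := fix C n (v : val) := if n is n'.+1 then
  exists x, T2 (@upd _ _ v St 1 x) /\
            C n' (@upd _ _ (@upd _ _ v St 1 x) St 0 x) else True.
have HC n : zero_def M (C n).
  elim: n => [|n IH] /=; first exact: zero_def_cst.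
  have := zero_def_ex St 1 (zero_def_and HT2 (zero_def_ren
    (fun s m => if s is St then (if m is 0 then 1 else m) else m) IH)).
  apply: zero_def_ext => v.
  have E x : vren (fun s m => if s is St then (if m is 0 then 1 else m) else m)
      (@upd _ _ v St 1 x) = @upd _ _ (@upd _ _ v St 1 x) St 0 x.
    by apply: valuation_eq => -[] [|m].
  by split=> -[x [H1 H2]]; exists x; split=> //; move: H2; rewrite E.
have [N HN] := zero_def_supported HT2.
have agr s0 n0 a (v w : val) : (forall s n, n < N ->
  lookup v s n = lookup w s n) ->
    forall s n, n < N ->
    lookup (@upd _ _ v s0 n0 a) s n = lookup (@upd _ _ w s0 n0 a) s n.
  move=> E s n lt; have [[<- <-]|ne] := pselect (s0 = s /\ n0 = n).
    by rewrite !lookup_upd.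
  by rewrite !lookup_upd_other// E.
have HCN n : supported N (C n).
  elim: n => [|n IH] v w E //=; split=> -[x [H1 H2]]; exists x; split.
  - exact: (proj1 (HN _ _ (agr St 1 x _ _ E)) H1).
  - exact: (proj1 (IH _ _ (agr St 0 x _ _ (agr St 1 x _ _ E))) H2).
  - exact: (proj2 (HN _ _ (agr St 1 x _ _ E)) H1).
  - exact: (proj2 (IH _ _ (agr St 0 x _ _ (agr St 1 x _ _ E))) H2).
have HT (v : val) : (forall n, v.1 n.+2 = p.1 n) -> v.2 = p.2 ->
    T2 v <-> T (v.1 1) (v.1 0).
  move=> E1 E2; apply: iff_sym.
  apply: (iff_trans (H (fun n => if n is 0 then v.1 1 else v.1 0))).
  apply/propeqP; congr R; congr pair; last by apply/funext => n /=; rewrite E2.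
  apply/funext => n /=; have [j [->|->]] := even_or_odd n.
    by rewrite !interleave_even; case: j.
  by rewrite !interleave_odd E1.
have HCE n (v : val) : (forall n, v.1 n.+2 = p.1 n) -> v.2 = p.2 ->
    C n v <-> chain_below n (v.1 0).
  elim: n v => [|n IH] v E1 E2 //=; split=> -[x [H1 H2]]; exists x; split.
  - by move/HT: H1; apply.
  - by move/IH: H2; apply.
  - by apply/HT.
  - by apply/IH.
have mono m j z : j <= m -> chain_below m z -> chain_below j z.
  elim: m j z => [|m IH] [|j]//= z le [x [Tx Hx]].
  by exists x; split=> //; exact: IH.
pose v0 : val := (fun n => p.1 n.-2, p.2).
have [|z Hz] := saturated_zero_def (v := v0) HC HCN.
  move=> k F; have [z Hz] := Hch (\max_i F i); exists z => i.
  apply/HCE => //; exact: mono (leq_bigmax i) Hz.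
by exists z => n; move: (Hz n) => /HCE; apply.
Qed.

End Saturation.

(** * Uniform definability of separation by a point *)

Section Separation.
Variables (L : language) (Mt : topologicalType) (Mb : Type).
Variables (M : structure L Mt Mb) (phi : formula L) (k : nat).
Hypothesis fo : fo_topological M phi k.
Notation val := (valuation Mt Mb).

(** This makes [A] one half of a clopen partition of the complement of [x], possibly with an empty
    half. Openness is taken in the whole space, where it is expressible by a formula. *)
Definition cuts x (A : set Mt) :=
  [/\ ~ A x, open A & open [set z | ~ A z /\ z <> x]].

Definition separates (f : formula L) x a y := exists w : val,
  [/\ cuts x (solset M f w), a <> x, y <> x &
      (solset M f w a <-> ~ solset M f w y)].

Lemma zero_def_open (P : val -> Prop) n : zero_def M P ->
  zero_def M (fun v => open [set z | P (@upd _ _ v St n z)]).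
Proof.
move=> HP; have := @zero_def_all _ _ _ _ St n _
  (zero_def_imp HP (zero_def_interior fo n n HP)).
have E v z : [set z' | P (@upd _ _ (@upd _ _ v St n z) St n z')] =
    [set z' | P (@upd _ _ v St n z')].
  apply/funext => z' /=; congr P.
  by apply: valuation_eq => -[] m //=; case: eqP.
apply: zero_def_ext => v; rewrite openE; split=> H z.
  by move=> /(H z); rewrite E /= eqxx.
by rewrite E /= eqxx => /H.
Qed.

Lemma zero_def_separates f :
  zero_def M (fun v => separates f (v.1 0) (v.1 1) (v.1 2)).
Proof.
have [N HN] := zero_def_supported (zero_def_sat M f).
(* The variables below [N] are left to the parameters of [f], which get bound. Positions [N.+1],
   [N.+2] and [N.+3] hold [x], [a] and [y], and [N.+4] the running point of the two openness
   conditions; a final renaming brings the first three to 0, 1 and 2. *)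
pose S i (w : val) := sat M (@upd _ _ w St 0 (w.1 i)) f.
have HS i : zero_def M (S i).
  have := zero_def_ren (fun s n => if s is St then
    (if n is 0 then i else n) else n) (zero_def_sat M f).
  apply: zero_def_ext => v; apply/propeqP; congr (sat M _ f).
  by apply: valuation_eq => -[] [].
pose body (w : val) := (~ S N.+1 w /\
  (open [set z | S N.+4 (@upd _ _ w St N.+4 z)] /\
   open [set z | (~ S N.+4 (@upd _ _ w St N.+4 z)) /\
           lookup (@upd _ _ w St N.+4 z) St N.+4 <>
           lookup (@upd _ _ w St N.+4 z) St N.+1])) /\
  ((lookup w St N.+2 <> lookup w St N.+1 /\
    lookup w St N.+3 <> lookup w St N.+1) /\
   (S N.+2 w <-> ~ S N.+3 w)).
have Hbody : zero_def M body.
  apply: zero_def_and.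
    apply: zero_def_and; first exact: zero_def_not.
    apply: zero_def_and; first exact: (@zero_def_open (S N.+4) N.+4 (HS _)).
    apply: (@zero_def_open (fun w => ~ S N.+4 w /\
      lookup w St N.+4 <> lookup w St N.+1) N.+4).
    by apply: zero_def_and; apply: zero_def_not => //; exact: zero_def_eq.
  apply: zero_def_and.
    by apply: zero_def_and; apply: zero_def_not; exact: zero_def_eq.
  by apply: zero_def_iff => //; exact: zero_def_not.
have [l1 Hl1] := variable_block St 0 N.
have [l2 Hl2] := variable_block Sb 0 N.
have Hl s n : List.In (s, n) (l1 ++ l2)%list <-> n < N.
  rewrite List.in_app_iff Hl1 Hl2 add0n /=.
  by split=> [[[]|[]]//|lt]; case: s; [left|right].
have bodyE (w : val) : body w <-> [/\ cuts (w.1 N.+1) (solset M f w),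
    w.1 N.+2 <> w.1 N.+1, w.1 N.+3 <> w.1 N.+1 &
      (solset M f w (w.1 N.+2) <-> ~ solset M f w (w.1 N.+3))].
  have E z : S N.+4 (@upd _ _ w St N.+4 z) = solset M f w z.
    apply/propext; rewrite /S /solset /= eqxx; apply: HN => -[] //= n lt.
    case: eqP => // _; case: eqP => // e.
    by move: lt; rewrite e ltnNge -addn4 leq_addr.
  have E1 : [set z | S N.+4 (@upd _ _ w St N.+4 z)] = solset M f w.
    by apply/funext => z; exact: E.
  have E2 : [set z | (~ S N.+4 (@upd _ _ w St N.+4 z)) /\
           lookup (@upd _ _ w St N.+4 z) St N.+4 <>
           lookup (@upd _ _ w St N.+4 z) St N.+1] =
       [set z | ~ solset M f w z /\ z <> w.1 N.+1].
    apply/funext => z; rewrite /mkset E lookup_upd lookup_upd_other//.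
    by move=> -[_] /eqP; rewrite !eqSS -addn3 -[X in _ == X]addn0 eqn_add2l.
  rewrite /body E1 E2 /cuts.
  by split=> [[[? [? ?]] [[? ?] ?]]|[[? ? ?] ? ? ?]].
pose r s n := if s is St then
  (match n - N with 2 => 1 | 3 => 2 | _ => 0 end)%N else n.
have := zero_def_ren r (zero_def_ex_list (l1 ++ l2)%list Hbody).
apply: zero_def_ext => v.
have rE j : (vren r v).1 (N + j)%N = v.1 (match j with 2 => 1 | 3 =>
  2 | _ => 0 end).
  change (v.1 (match N + j - N with 2 => 1 | 3 => 2 | _ => 0 end)%N =
    v.1 (match j with 2 => 1 | 3 => 2 | _ => 0 end)).
  by rewrite addKn.
have rX : (vren r v).1 N.+1 = v.1 0 by rewrite -(addn1 N) rE.
have rA : (vren r v).1 N.+2 = v.1 1 by rewrite -(addn2 N) rE.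
have rY : (vren r v).1 N.+3 = v.1 2 by rewrite -(addn3 N) rE.
have far (w : val) : (forall s n, ~ List.In (s, n) (l1 ++ l2)%list ->
    lookup w s n = lookup (vren r v) s n) ->
    [/\ w.1 N.+1 = v.1 0, w.1 N.+2 = v.1 1 & w.1 N.+3 = v.1 2].
  move=> E; rewrite -rX -rA -rY.
  by split; apply: (E St); rewrite Hl => lt; move: lt;
    rewrite ltnNge ?leqW.
split=> [[w [E /bodyE]]|[w0 H]].
  by have [-> -> ->] := far w E => H; exists w.
pose w : val := (fun n => if n < N then w0.1 n else (vren r v).1 n,
                 fun n => if n < N then w0.2 n else (vren r v).2 n).
have E s n : ~ List.In (s, n) (l1 ++ l2)%list ->
    lookup w s n = lookup (vren r v) s n.
  by rewrite Hl; case: s => /=; case: ifP.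
exists w; split=> //; apply/bodyE; have [-> -> ->] := far w E.
suff -> : solset M f w = solset M f w0 by [].
apply/seteqP; suff Es z : solset M f w z <-> solset M f w0 z by split=> z /Es.
by apply: HN => -[] n /= ->.
Qed.

Hypothesis saturated : omega_saturated M.

(** Compactness: if no finite list of formulas were enough, the conditions that [f] separates no two
    points at [x], for all [f], would be finitely satisfiable. A point realizing all of them
    contradicts the hypothesis. *)
Lemma uniform_separation :
  (forall x, exists f a y, separates f x a y) ->
  exists m (F : 'I_m -> formula L), forall x, exists i a y, separates (F i) x a
    y.
Proof.
move=> H; apply: contrapT => no.
case: (inh_t M) => c; case: (inh_b M) => b.
pose P (f : formula L) (v : val) := ~ exists a y, separates f (v.1 0) a y.
have [f||m F|x Hx] := @saturated_zero_def _ _ _ M saturated _ P 1 (fun=> c,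
  fun=> b).
- have := zero_def_not (zero_def_ex St 1
    (zero_def_ex St 2 (zero_def_separates f))).
  by apply: zero_def_ext => v.
- by move=> f v w E; rewrite /P; have := E St 0 (ltnSn 0) => /= ->.
- apply: contrapT => Hx; apply: no; exists m, F => x.
  apply: contrapT => Hi; apply: Hx; exists x => i [a [y Hs]]; apply: Hi.
  by exists i, a, y.
have [f [a [y Hs]]] := H x.
by apply: (Hx f); exists a, y.
Qed.

Lemma pdef_ex_ord m (P : 'I_m -> (nat -> Mt) -> Prop) :
  (forall i, pdef M (P i)) -> pdef M (fun e => exists i, P i e).
Proof.
elim: m P => [|m IH] P HP.
  apply: (@pdef_ext _ _ _ _ (fun=> False)) => [e|]; first by split=> // -[[]].
  by apply: pdef_cst; [exact: inh_t M|exact: inh_b M].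
apply: (pdef_ext _ (pdef_or (HP ord0) (IH _ (fun i => HP (lift ord0 i))))).
move=> e; split=> [[?|[i ?]]|[i]]; [by exists ord0|by exists (lift ord0 i)|].
by case: (unliftP ord0 i) => [j ->|->]; [right; exists j|left].
Qed.

Lemma pdef_separates m (F : 'I_m -> formula L) :
  pdef M (fun e => exists i, separates (F i) (e 0) (e 1) (e 2)).
Proof.
apply: pdef_ex_ord => i; case: (inh_b M) => b.
by have := pdef_zero_def (zero_def_separates (F i)) (fun=> b).
Qed.

End Separation.

(** * The tree order of separation by points *)

(** What the order arguments use about the class [D] of definable sets. From here on they are purely
    topological and mention no formula. *)
Record tame (T : topologicalType) (D : set (set T)) : Prop := Tame {
  tame_closed1 : forall x : T, closed [set x];
  tame_set1 : forall x : T, D [set x];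
  tameC : forall A, D A -> D (~` A);
  tameI : forall A B, D A -> D B -> D (A `&` B);
  tame_interior : forall A, D A -> D (interior A);
  tame_basis : forall O (x : T), open O -> O x ->
    exists B, [/\ D B, open B, B x & B `<=` O];
  tame_boundary : forall A, D A -> finite_set (closure A `\` interior A);
  tame_connected : forall K, D K -> open K -> closed K -> K = set0 \/ K = setT
}.

Definition above (T : Type) (lt : T -> T -> Prop) x : set T := [set y | lt x y].

Definition below (T : Type) (lt : T -> T -> Prop) x : set T := [set y | lt y x].

(** When [x] is not the root, this is the part of the complement of [x] that contains the root, see
    [root_side]. *)
Definition side (T : Type) (lt : T -> T -> Prop) x : set T :=
  [set y | y <> x /\ ~ lt x y].

(** All points of the tree between [x] and [y], side branches included. *)
Definition fat (T : Type) (lt : T -> T -> Prop) x y : set T :=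
  above lt x `&` side lt y.

(** [lt x y] is meant to say that [x] separates the root [a] from [y]. *)
Record cut_order (T : topologicalType) (D : set (set T)) (a : T)
    (lt : T -> T -> Prop) : Prop := CutOrder {
  cut_irr : forall x, ~ lt x x;
  cut_minl : forall x, ~ lt x a;
  cut_minr : forall x, ~ lt a x;
  cut_above : forall x, x <> a -> exists y, lt x y;
  cut_open_above : forall x, open (above lt x);
  cut_open_side : forall x, open (side lt x);
  cut_def_above : forall x, D (above lt x);
  cut_def_below : forall x, D (below lt x);
  cut_nontrivial : exists x, x <> a
}.

Lemma ex_witness (T : Type) (P : T -> Prop) (x0 : T) :
  exists x, (exists y, P y) -> P x.
Proof.
by have [[x Px]|no] := pselect (exists y, P y); [exists x|exists x0].
Qed.

Section CutOrder.
Variables (T : topologicalType) (D : set (set T)) (a : T) (lt : T -> T -> Prop).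
Hypotheses (tm : tame D) (co : cut_order D a lt).
Local Notation above := (above lt).
Local Notation below := (below lt).
Local Notation side := (side lt).
Local Notation fat := (fat lt).

Lemma tame0 : D set0.
Proof.
rewrite -(setICr [set a]); apply: tameI => //; first exact: tame_set1.
by apply: tameC => //; exact: tame_set1.
Qed.

Lemma tameU A B : D A -> D B -> D (A `|` B).
Proof.
move=> DA DB; rewrite -(setCK (A `|` B)) setCU.
by apply: tameC => //; apply: tameI => //; apply: tameC.
Qed.

Lemma tame_side x : D (side x).
Proof.
rewrite (_ : side x = ~` [set x] `&` ~` above x).
  apply: tameI => //; apply: tameC => //; first exact: tame_set1.
  exact: (cut_def_above co).
by apply/seteqP; split.
Qed.

Lemma tame_fat x y : D (fat x y).
Proof. by apply: tameI => //; [exact: cut_def_above co _|exact: tame_side]. Qed.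

Lemma open_fat x y : open (fat x y).
Proof.
by apply: openI; [exact: cut_open_above co _|exact: cut_open_side co _].
Qed.

Local Hint Resolve tame0 tame_side tame_fat open_fat : core.
Local Hint Extern 0 (D (above _)) => exact: (cut_def_above co) : core.
Local Hint Extern 0 (D (below _)) => exact: (cut_def_below co) : core.
Local Hint Extern 0 (D [set _]) => exact: (tame_set1 tm) : core.
Local Hint Extern 0 (open (above _)) => exact: (cut_open_above co) : core.
Local Hint Extern 0 (open (side _)) => exact: (cut_open_side co) : core.

Lemma lt_irr x : ~ lt x x. Proof. exact: (cut_irr co). Qed.

Lemma cut3 x z : [\/ lt x z, z = x | side x z].
Proof.
have [H|H] := pselect (lt x z); first by constructor 1.
by have [->|ne] := pselect (z = x); [constructor 2|constructor 3].
Qed.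

Lemma side_nlt x z : side x z -> ~ lt x z. Proof. by case. Qed.

Lemma closed_coverP (K V : set T) : open V ->
  (forall z, K z -> V z -> False) -> (forall z, K z \/ V z) -> closed K.
Proof.
move=> oV dis cov; rewrite -(setCK K); apply: open_closedC.
rewrite (_ : ~` K = V)//; apply/seteqP; split=> z /=.
  by move=> nK; case: (cov z).
by move=> Vz /dis; exact.
Qed.

(** The test sets are open in the whole space and need to be disjoint on [Y] only. *)
Definition dconnected (Y : set T) :=
  forall O1 O2, D O1 -> D O2 -> open O1 -> open O2 ->
  Y `<=` O1 `|` O2 -> (forall z, Y z -> O1 z -> O2 z -> False) ->
  Y `<=` O1 \/ Y `<=` O2.

(** If [O1] is the part that contains [x], then [W] meets [O2] in a set that is clopen in the whole
    space. That set omits [x], so it is empty. *)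
Lemma dconnected_add_point W x : D W -> open W -> ~ W x ->
  closed (W `|` [set x]) ->
  dconnected (W `|` [set x]).
Proof.
move=> DW oW Wx cl O1 O2; wlog O1x : O1 O2 / O1 x.
  move=> H D1 D2 o1 o2 cov dis; have [O1x|O2x] : (O1 `|` O2) x.
  - by apply: cov; right.
  - exact: H.
  - rewrite orC; apply: H => //; first by move=> z /cov; rewrite setUC.
    by move=> z Yz ? ?; apply: (dis z).
move=> D1 D2 o1 o2 cov dis; left.
have [||||K0] := tame_connected tm (K := W `&` O2).
- exact: tameI.
- exact: openI.
- apply: (@closed_coverP _ (~` (W `|` [set x]) `|` O1)).
  + by apply: openU => //; exact: closed_openC.
  + by move=> z [Wz O2z] [|O1z]; [apply; left|apply: (dis z) => //; left].
  + move=> z; have [Yz|nYz] := pselect ((W `|` [set x]) z); last by right; left.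
    have [O1z|O2z] := cov z Yz; first by right; right.
    case: Yz => [Wz|->]; first by left.
    by right; right.
- move=> K0 z Yz; have [//|O2z] := cov z Yz.
  case: Yz => [Wz|->//]; suff: (set0 : set T) z by [].
  by rewrite -K0.
- by exfalso; apply: Wx; have : setT x by []; rewrite -K0 => -[].
Qed.

Lemma dconnected_side x : dconnected (side x `|` [set x]).
Proof.
apply: dconnected_add_point => //; first by case.
apply: (@closed_coverP _ (above x)) => //.
- by move=> z [[_ n] /n//|-> /lt_irr].
- by move=> z; case: (cut3 x z) => H; [right|left; right|left; left].
Qed.

Lemma dconnected_above x : dconnected (above x `|` [set x]).
Proof.
apply: dconnected_add_point => //; first exact: lt_irr.
apply: (@closed_coverP _ (side x)) => //.
- by move=> z [? [_ /(_ _)]|-> []].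
- by move=> z; case: (cut3 x z) => H; [left; left|left; right|right].
Qed.

Lemma dconnected_cut Y y : dconnected Y -> ~ Y y ->
  Y `<=` side y \/ Y `<=` above y.
Proof.
move=> cY nY; apply: cY => //.
  by move=> z Yz; case: (cut3 y z) => H; [right|move: nY; rewrite -H|left].
by move=> z _ [_ n] /n.
Qed.

Lemma root_side x : x <> a -> side x a.
Proof. by move=> ne; split; [exact/nesym|exact: (cut_minl co)]. Qed.

Lemma lt_neq_root x y : lt x y -> x <> a.
Proof. by move=> + e; rewrite e => /(cut_minr co). Qed.

Lemma lt_neq_root_r x y : lt x y -> y <> a.
Proof. by move=> + e; rewrite e => /(cut_minl co). Qed.

(** The points of [side x] together with [x] form a connected set that misses [y]. It contains the
    root, so it lies entirely on the root side of [y]. Transitivity of [lt] follows from this. *)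
Lemma lt_side_sub x y z : lt x y -> side x z \/ z = x -> side y z.
Proof.
move=> xy Hz; have [||H|H] := dconnected_cut (Y := side x `|` [set x]) (y := y).
- exact: dconnected_side.
- by move=> [[_ n]|yx]; [exact: n|move: xy; rewrite /= in yx *;
    rewrite yx => /lt_irr].
- exact: H.
- have /(cut_minl co)// : lt y a.
  by apply: H; left; apply: root_side; exact: lt_neq_root xy.
Qed.

Lemma lt_side x y : lt x y -> side y x.
Proof. by move=> xy; apply: (lt_side_sub xy); right. Qed.

Lemma lt_trans x y z : lt x y -> lt y z -> lt x z.
Proof.
move=> xy yz; case: (cut3 x z) => // H; exfalso.
  by apply: (side_nlt _ yz); apply: (lt_side_sub xy); right.
by apply: (side_nlt _ yz); apply: (lt_side_sub xy); left.
Qed.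

(** When [y] lies in [side x], the connected set formed by [x] and the points above it misses [y].
    It contains [z], which is above [y], so all of it is above [y], in particular [x]. *)
Lemma below_chain x y z : lt x z -> lt y z -> [\/ lt x y, y = x | lt y x].
Proof.
move=> xz yz; case: (cut3 x y) => H; [by constructor 1|by constructor 2|].
constructor 3; have [||K|K] := dconnected_cut (Y :=
  above x `|` [set x]) (y := y).
- exact: dconnected_above.
- by case: H => ne n [/n|].
- by have [_ /(_ yz)] : side y z by apply: K; left.
- by apply: K; right.
Qed.

(** Otherwise [above x] would be clopen, although it is nonempty and omits [x]. *)
Lemma above_near x (O : set T) : x <> a -> open O -> O x ->
  exists y, O y /\ lt x y.
Proof.
move=> ne oO Ox; apply: contrapT => no.
have [||||K0] := tame_connected tm (K := above x) => //.
- apply: (@closed_coverP _ (side x `|` O)).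
  + exact: openU.
  + by move=> z xz [[]//|Oz]; apply: no; exists z.
  + by move=> z; case: (cut3 x z) => H; [left|right; right; rewrite H|right;
      left].
- by move=> K0; have [y xy] := cut_above co ne; have : above x y by [];
    rewrite K0.
- by apply: (@lt_irr x); have : setT x by []; rewrite -K0.
Qed.

Lemma side_near x (O : set T) : x <> a -> open O -> O x ->
  exists y, O y /\ side x y.
Proof.
move=> ne oO Ox; apply: contrapT => no.
have [||||K0] := tame_connected tm (K := side x) => //.
- apply: (@closed_coverP _ (above x `|` O)).
  + exact: openU.
  + by move=> z xz [/(side_nlt xz)//|Oz]; apply: no; exists z.
  + by move=> z; case: (cut3 x z) => H; [right; left|right; right;
      rewrite H|left].
- by move=> K0; have := root_side ne; rewrite K0.
- by have : setT x by []; rewrite -K0 => -[].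
Qed.

(** The second condition excludes side branches: by [below_chain], [fat u v] is then a chain. *)
Definition arc u v := lt u v /\ forall w, fat u v w -> lt w v.

Lemma lt_asym x y : lt x y -> ~ lt y x.
Proof. by move=> xy /(lt_trans xy)/lt_irr. Qed.

(** The complement of [Z] is connected and contains [a] and [v], but each point
    of [Z] separates [a] from [v]. *)
Lemma hollow u v Z x : arc u v -> D Z -> open Z -> Z `<=` fat u v ->
  closed (Z `|` [set x]) -> ~ Z x -> forall w, ~ Z w.
Proof.
move=> [uv lv] DZ oZ ZF cl nZx w Zw.
have E : ~` Z = ~` (Z `|` [set x]) `|` [set x].
  apply/seteqP; split=> z; rewrite setCU; last by case=> [[]|->].
  by move=> nZ; have [->|ne] := pselect (z = x); [right|left].
have : dconnected (~` Z).
  rewrite E; apply: dconnected_add_point.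
  - by apply: tameC => //; exact: tameU.
  - exact: closed_openC.
  - by case; right.
  - by rewrite -E; exact: open_closedC.
move=> cZ; have [|H|H] := dconnected_cut (y := w) cZ; first by apply.
  have /H/side_nlt : (~` Z) v by move=> /ZF[_ []].
  by apply; apply: lv; exact: ZF.
have /H : (~` Z) a by move=> /ZF[/(cut_minl co)].
exact: (cut_minl co).
Qed.

(** Suppose [O1] and [O2] split the set, with [w] in [O1] and [w'] in [O2]. The part of [O2] on the
    same side of [w] as [w'] becomes closed when one end is added, [v] if [w'] is above [w] and [u]
    otherwise, so [hollow] forces it to be empty. *)
Lemma dconnected_fat u v : arc u v -> dconnected (fat u v).
Proof.
move=> luv; have [uv lv] := luv.
suff H O1 O2 w w' : D O1 -> D O2 -> open O1 -> open O2 ->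
    fat u v `<=` O1 `|` O2 -> (forall z, fat u v z -> O1 z -> O2 z -> False) ->
    fat u v w -> O1 w -> fat u v w' -> O2 w' -> False.
  move=> O1 O2 D1 D2 o1 o2 cov dis; apply: contrapT => /not_orP[n1 n2].
  have {n1}[w1 [F1 n1]] : exists w, fat u v w /\ ~ O1 w.
    by apply: contrapT => no; apply: n1 => z Fz; apply: contrapT => ?;
      apply: no; exists z.
  have {n2}[w2 [F2 n2]] : exists w, fat u v w /\ ~ O2 w.
    by apply: contrapT => no; apply: n2 => z Fz; apply: contrapT => ?;
      apply: no; exists z.
  by case: (cov _ F1) => // ?; case: (cov _ F2) => // ?; exact: (H O1 O2 w2 w1).
move=> D1 D2 o1 o2 cov dis Fw O1w Fw' O2w'.
have wv := lv _ Fw; have uw : lt u w by case: Fw.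
(* [V] is the portion of the open complement that serves both positions of [w']. *)
pose V := side u `|` above v `|` (fat u v `&` O1).
have oV : open V by do 2?[apply: openU => //]; exact: openI.
case: (cut3 w w') => [ww'|ww'|ww'].
- apply: (@hollow u v (fat u v `&` O2 `&` above w) v luv _ _ _ _ _ w') => //.
  + by do 2?[apply: tameI => //].
  + by do 2?[apply: openI => //].
  + by move=> z [[]].
  + apply: (@closed_coverP _ (V `|` side w)).
    * exact: openU.
    * move=> z [[[[uz vz] O2z] wz]|->].
        move=> [[[[_ /(_ uz)//]|/(side_nlt vz)//]|[Fz O1z]]|[_ /(_ wz)//]].
        exact: (dis z).
      by move=> [[[[_ /(_ uv)//]|/lt_irr//]|[[_ []]]//]|[_ /(_ wv)//]].
    * move=> z; case: (cut3 u z) => uz; last 2 first.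
      - by right; right; rewrite uz; exact: lt_side.
      - by right; left; left; left.
      case: (cut3 v z) => vz; [by right; left; left; right|by left; right|].
      have [O1z|O2z] := cov z (conj uz vz); first by right; left; right.
      by case: (cut3 w z) => wz; [left; left|right; left; right;
        rewrite wz|right; right].
  + by move=> [[[_ []]]].
- by apply: (dis w) => //; rewrite -ww'.
- apply: (@hollow u v (fat u v `&` O2 `&` side w) u luv _ _ _ _ _ w') => //.
  + by do 2?[apply: tameI => //].
  + by do 2?[apply: openI => //].
  + by move=> z [[]].
  + apply: (@closed_coverP _ (V `|` above w)).
    * exact: openU.
    * move=> z [[[[uz vz] O2z] wz]|->].
        move=> [[[[_ /(_ uz)//]|/(side_nlt vz)//]|[Fz O1z]]|/(side_nlt wz)//].
        exact: (dis z).
      by move=> [[[[]//|/(lt_asym uv)//]|[[/lt_irr]]//]|/(lt_asym uw)].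
    * move=> z; case: (cut3 u z) => uz; last 2 first.
      - by left; right.
      - by right; left; left; left.
      case: (cut3 v z) => vz; [by right; left; left; right|by right; right;
        rewrite vz|].
      have [O1z|O2z] := cov z (conj uz vz); first by right; left; right.
      by case: (cut3 w z) => wz; [right; right|right; left; right;
        rewrite wz|left; left].
  + by move=> [[[/lt_irr]]].
Qed.

Lemma arc_sub x y u v : arc x y -> fat x y u -> fat x y v -> lt u v ->
  arc u v /\ fat u v `<=` fat x y.
Proof.
move=> [xy lxy] Fu Fv uv.
have sub : fat u v `<=` fat x y.
  move=> z [uz vz]; split; first by apply: lt_trans uz; case: Fu.
  by apply: (lt_side_sub (lxy _ Fv)); left.
split=> //; split=> // z Fz.
have [H|H|//] := below_chain (lxy _ Fv) (lxy _ (sub _ Fz)).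
- by case: Fz => _ /side_nlt.
- by case: Fz => _ []; rewrite H.
Qed.

Lemma infinite_pigeonhole (F : finType) (f : T -> F) (N : set T) :
  ~ finite_set N -> exists x y, [/\ N x, N y, x <> y & f x = f y].
Proof.
move=> inf; apply: contrapT => no; apply: inf.
have [g Hg] : exists g : F -> T, forall x, N x -> g (f x) = x.
  have [g Hg] := choice (fun c : F => ex_witness (fun x => N x /\ f x = c) a).
  exists g => x Nx; have [|gN gE] := Hg (f x); first by exists x.
  by apply: contrapT => ne; apply: no; exists (g (f x)), x.
apply: (@sub_finite_set _ _ (range g)); first by move=> x Nx; exists (f x);
  last exact: Hg.
exact/finite_image/finite_finset.
Qed.

(** If the finite boundary of [below z] met every [fat x y] with [x < y] in the
    interior of [below z], infinitely many such points would have distinct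
    traces [{b | x < b}] on it. *)
Lemma exists_arc z O : open O -> ~ finite_set (below z `&` O) ->
  exists u v w, [/\ arc u v, fat u v w & O w].
Proof.
move=> oO inf; have Dz : D (below z) by [].
have bd := tame_boundary tm Dz; have [s Hs] := proj1 (finite_seqP _) bd.
pose N := interior (below z) `&` O.
have infN : ~ finite_set N.
  move=> finN; apply: inf;
    apply: sub_finite_set (_ : finite_set (N `|` [set` s])).
    move=> x [xz Ox]; have [ix|nix] := pselect (interior (below z) x).
      by left.
    by right; rewrite -Hs; split=> //; exact: subset_closure.
  by rewrite finite_setU -Hs.
pose f x : (size s).-tuple bool := map_tuple (fun b =>
  `[<lt x b>]) (in_tuple s).
have [x [y [[ix Ox] [iy Oy] ne /(congr1 val)/= /eq_in_map fE]]] :=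
  infinite_pigeonhole f infN.
wlog xy : x y ix Ox iy Oy ne fE / lt x y.
  move=> H; have [xy|e|yx] :=
    below_chain (interior_subset ix) (interior_subset iy).
  - exact: (H x y).
  - by case: ne.
  - by apply: (H y x) => //; [exact/nesym|move=> b /fE].
(* Equal traces mean that a boundary point above [x] is also above [y]. *)
have noB b : (closure (below z) `\` interior (below z)) b -> ~ fat x y b.
  move=> Bb [xb /side_nlt yb]; apply: yb; apply/asboolP; rewrite -fE.
    exact/asboolP.
  by move: Bb; rewrite Hs.
(* As [fat x y] misses the boundary of [below z], its part outside [below z] is clopen. It omits
   [x], hence is empty, and [fat x y] is a chain below [z]. *)
have [||||K0] := tame_connected tm (K := fat x y `&` interior (~` below z)).
- by apply: tameI => //; apply: (tame_interior tm); exact: tameC.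
- by apply: openI => //; exact: open_interior.
- apply: (@closed_coverP _ (side x `|` above y `|` interior (below z))).
  + apply: openU; last exact: open_interior.
    exact: openU.
  + move=> w [[xw yw] nw] [[/side_nlt/(_ xw)//|/(side_nlt yw)//]|iw].
    exact: (interior_subset nw (interior_subset iw)).
  + move=> w; case: (cut3 x w) => xw; last 2 first.
    * by right; right; rewrite xw.
    * by right; left; left.
    case: (cut3 y w) => yw; first by right; left; right.
      by right; right; rewrite yw.
    have [iw|niw] := pselect (interior (below z) w); first by right; right.
    left; split=> //; rewrite interiorC => cw.
    by apply: (noB w).
- move=> K0; have sub : fat x y `<=` below z.
    move=> w Fw; have [iw|niw] := pselect (interior (below z) w).
      exact: interior_subset.
    suff: (set0 : set T) w by [].
    rewrite -K0; split=> //; rewrite interiorC => cw.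
    by apply: (noB w).
  have lxy : arc x y.
    split=> // w Fw; have yz := interior_subset iy.
    have [H|H|//] := below_chain yz (sub _ Fw).
      by case: Fw => _ /side_nlt.
    by case: Fw => _ []; rewrite H.
  (* The arc must meet [O]: since [x] is in [O], there are points of [O] just above [x]. *)
  have [|||w [[yw Ow] xw]] := @above_near x (side y `&` O).
  + exact: lt_neq_root xy.
  + exact: openI.
  + by split=> //; exact: lt_side.
  + by exists x, y, w.
- by have : setT x by []; rewrite -K0 => -[[/lt_irr]].
Qed.

(** * Points with an arc as neighbourhood *)

Definition good : set T := [set w | exists u v, arc u v /\ fat u v w].

Lemma open_good : open good.
Proof.
rewrite openE => w [u [v [luv Fw]]].
apply: (@filterS _ _ _ (fat u v)); first by move=> z Fz; exists u, v.
exact: open_nbhs_nbhs.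
Qed.

Lemma chain_below_seq (O : set T) n z :
  chain_below (fun x y => O x /\ lt x y) n z ->
  exists s : seq T, [/\ uniq s, size s = n & forall x, x \in s ->
    O x /\ lt x z].
Proof.
elim: n z => [|n IH] z /=; first by exists [::].
move=> [x [[Ox xz] /IH[s [us ss Hs]]]]; exists (x :: s); split.
- rewrite /= us andbT; apply/negP => /Hs[_].
  exact: lt_irr.
- by rewrite /= ss.
- move=> y; rewrite inE => /orP[/eqP ->//|/Hs[Oy yx]]; split=> //.
  exact: lt_trans xz.
Qed.

(** Otherwise some open set [O] misses [good]; then each [below z] has finite
    trace on [O], although every point of [O] has points of [O] above it. *)
Lemma finite_bad : D good ->
  (forall O, D O ->
    (forall n, exists z, chain_below (fun x y => O x /\ lt x y) n z) ->
    exists z, forall n, chain_below (fun x y => O x /\ lt x y) n z) ->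
  finite_set (~` good).
Proof.
move=> Dg sat; apply: contrapT => inf.
pose O := interior (~` good).
have DO : D O by apply: (tame_interior tm); exact: tameC.
have oO : open O by exact: open_interior.
have infO : ~ finite_set O.
  move=> finO; apply: inf; apply: sub_finite_set (_ : finite_set
    (O `|` (closure (~` good) `\` interior (~` good)))).
    move=> x gx; have [ix|nix] := pselect (O x); first by left.
    by right; split=> //; exact: subset_closure.
  rewrite finite_setU; split=> //.
  by apply: (tame_boundary tm); exact: tameC.
have fin z : finite_set (below z `&` O).
  apply: contrapT => /(exists_arc oO)[u [v [w [luv Fw Ow]]]].
  by apply: (interior_subset Ow); exists u, v.
(* Climbing with [above_near] gives chains in [O] of every finite length; saturation gives a single
   [z] that tops chains of all lengths. *)
have [n|z Hz] := sat O DO.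
  suff [z [_ _ Hz]] : exists z, [/\ O z, z <> a &
      chain_below (fun x y => O x /\ lt x y) n z] by exists z.
  elim: n => [|n [z [Oz za Hz]]].
    apply: contrapT => no; apply: infO.
    apply: sub_finite_set (finite_set1 a) => x Ox; apply: contrapT => ne.
    by apply: no; exists x.
  have [y [Oy zy]] := above_near za oO Oz.
  by exists y; split=> //; [exact: lt_neq_root_r zy|exists z].
have [t Ht] := proj1 (finite_seqP _) (fin z).
(* A chain with one more point than [O] has below [z]. *)
have [s [us ss Hs]] := chain_below_seq (Hz (size t).+1).
have : size s <= size t.
  apply: uniq_leq_size us _ => x /Hs[Ox xz].
  have : (below z `&` O) x by [].
  by rewrite Ht.
by rewrite ss ltnn.
Qed.

(** * The order on a component of the set of good points *)

Section Component.
Variable C : set T.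
Hypotheses (DC : D C) (oC : open C) (cC : dconnected C) (Cgood : C `<=` good).
Hypotheses (Dco : D (good `\` C)) (oco : open (good `\` C)).

(** By [key], comparability with [z] is constant along each arc. Arcs are neighbourhoods of the
    points of [C], so it is a clopen condition on the connected set [C], and it holds at [z]. *)
Lemma component_chain z w : C z -> C w -> [\/ lt z w, w = z | lt w z].
Proof.
move=> Cz; pose cmp : set T := above z `|` [set z] `|` below z.
have Dcmp : D cmp by apply: tameU => //; exact: tameU.
have key x y u v : arc x y -> fat x y u -> fat x y v -> cmp u -> cmp v.
  move=> [xy lxy] Fu Fv cu.
  have byw p : lt v p -> lt z p -> cmp v.
    move=> vp zp; have [H|H|H] := below_chain zp vp.
    - by left; left.
    - by left; right.
    - by right.
  have xv : lt x v by case: Fv.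
  case: (cut3 y z) => yz.
  - by right; apply: lt_trans yz; exact: lxy.
  - by right; rewrite yz; exact: lxy.
  - case: (cut3 x z) => xz.
    + by apply: (byw y); [exact: lxy|exact: lxy].
    + by left; left; rewrite xz.
    + have zx : lt z x.
        have zNx : ~ lt x z by apply: side_nlt.
        case: cu => [[zu|uz]|uz].
        * have xu : lt x u by case: Fu.
          have [//|e|//] := below_chain zu xu.
          by case: xz => ne; rewrite e in ne.
        * by case: zNx; rewrite -uz; case: Fu.
        * by case: zNx; apply: lt_trans uz; case: Fu.
      by left; left; exact: lt_trans xv.
have op (K : set T) : (forall x y u v, arc x y -> fat x y u -> fat x y v ->
  K u -> K v) ->
    open (C `&` K).
  move=> HK; rewrite openE => u [Cu Ku]; have [x [y [lxy Fu]]] := Cgood Cu.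
  apply: (@filterS _ _ _ (C `&` fat x y)).
    by move=> v [Cv Fv]; split=> //; exact: (HK x y u v).
  by apply: open_nbhs_nbhs; split=> //; exact: openI.
have [||||||H|H] := cC (O1 := C `&` cmp) (O2 := C `&` ~` cmp).
- exact: tameI.
- by apply: tameI => //; exact: tameC.
- exact: op.
- by apply: op => x y u v lxy Fu Fv nu /(key _ _ _ _ lxy Fv Fu).
- by move=> u Cu; have [?|?] := pselect (cmp u); [left|right].
- by move=> u _ [_ ?] [_].
- by move=> /H[_ [[zw|->]|wz]]; [constructor 1|constructor 2|constructor 3].
- by have [_ []] := H _ Cz; left; right.
Qed.

(** An arc around [w] is connected and consists of good points, so it cannot leave [C]. *)
Lemma component_fat w : C w ->
  exists x y, [/\ arc x y, fat x y w & fat x y `<=` C].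
Proof.
move=> Cw; have [x [y [lxy Fw]]] := Cgood Cw; exists x, y; split=> //.
have [||||||//|H] := dconnected_fat lxy (O1 := C) (O2 := good `\` C) => //.
- move=> z Fz; have [Cz|nCz] := pselect (C z); [by left|right].
  by split=> //; exists x, y.
- by move=> z _ Cz [].
- by have [] := H _ Fw.
Qed.

(** Both ends are found near [w] inside an arc around [w] by [side_near] and [above_near]; subarcs
    of an arc are arcs again. *)
Lemma shrink w (N : set T) : C w -> open N -> N w -> exists u v,
  [/\ C u /\ C v, N u /\ N v, lt u w /\ lt w v &
      [/\ fat u v `<=` C, arc u w & arc w v]].
Proof.
move=> Cw oN Nw; have [x [y [lxy Fw sub]]] := component_fat Cw.
have xw : lt x w by case: Fw.
have wa : w <> a by exact: lt_neq_root_r xw.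
have oNF : open (N `&` fat x y) by exact: openI.
have [v [[Nv Fv] wv]] := above_near wa oNF (conj Nw Fw).
have [u [[Nu Fu] wu]] := side_near wa oNF (conj Nw Fw).
have uw : lt u w.
  have [H|H|//] := below_chain (proj2 lxy _ Fw) (proj2 lxy _ Fu).
    by have := side_nlt wu.
  by case: wu => [].
have [luv suv] := arc_sub lxy Fu Fv (lt_trans uw wv).
exists u, v; split; try by split => //; apply: sub.
split; first by move=> z /suv /sub.
  by have [] := arc_sub lxy Fu Fw uw.
by have [] := arc_sub lxy Fw Fv wv.
Qed.

Notation itv := (ointerval C lt).

(** Connectedness is carried along with the shape, because it decides whether an interval without
    boundary points of a set lies inside or outside that set. *)
Definition connected_itv (I : set T) := dconnected I /\ exists lo hi,
  [/\ endpoint C lo, endpoint C hi & I = itv lo hi].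

(** On a chain, [side y] cuts out the points below [y]. This makes intervals open, as [side y] is
    open. *)
Lemma component_lt_side x y : C x -> C y -> lt x y <-> side y x.
Proof.
move=> Cx Cy; split; first exact: lt_side.
by move=> [ne n]; have [//|e|//] := component_chain Cx Cy; case: ne.
Qed.

Lemma itvE lo hi : endpoint C lo -> endpoint C hi ->
  itv lo hi = C `&` ((if lo is Some p then above p else setT) `&`
                     (if hi is Some q then side q else setT)).
Proof.
move=> Clo Chi; apply/seteqP; split=> x.
  move=> [Cx H1 H2]; split=> //; split; first by case: lo Clo H1.
  by case: hi Chi H2 => // q Cq /lt_side.
move=> [Cx [H1 H2]]; split=> //; first by case: lo Clo H1.
by case: hi Chi H2 => // q Cq H2; apply/component_lt_side.
Qed.

Lemma open_itv lo hi : endpoint C lo -> endpoint C hi -> open (itv lo hi).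
Proof.
move=> Clo Chi; rewrite itvE//; apply: openI => //; apply: openI.
  by case: lo {Clo} => [p|] //; exact: openT.
by case: hi {Chi} => [p|] //; exact: openT.
Qed.

Lemma tame_itv lo hi : endpoint C lo -> endpoint C hi -> D (itv lo hi).
Proof.
have DT : D setT by rewrite -setC0; exact: tameC.
move=> Clo Chi; rewrite itvE//; apply: tameI => //; apply: tameI => //.
  by case: lo {Clo}.
by case: hi {Chi}.
Qed.

Lemma connected_itv_component : connected_itv C.
Proof. by split=> //; exists None, None; split=> //; apply/seteqP;
  split=> // x []. Qed.

(** Given a splitting, a short arc [fat p v] just above [p] is connected and lies in one part, say
    [O1]. Enlarging that part by [side p] and by an arc around [p] gives a splitting of all of [I],
    which is connected. *)
Lemma connected_itv_above I p : connected_itv I -> I p ->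
  connected_itv (I `&` above p).
Proof.
move=> [cI [lo [hi [Clo Chi IE]]]] Ip.
have oI : open I by rewrite IE; exact: open_itv.
have DI : D I by rewrite IE; exact: tame_itv.
have IC : I `<=` C by rewrite IE => x [].
have Cp : C p by exact: IC.
split; last first.
  exists (Some p), hi; split=> //; rewrite IE; apply/seteqP; split=> x.
    by move=> [[Cx H1 H2] px].
  move=> [Cx px H2]; split=> //; split=> //.
  case: lo {Clo} IE => // q IE; apply: lt_trans px.
  by move: Ip; rewrite IE => -[].
move=> O1 O2 D1 D2 o1 o2 cov dis.
have [u [v [[Cu Cv] [Iu Iv] [up pv] [sub _ lpv]]]] := shrink Cp oI Ip.
have Fsub : fat p v `<=` I `&` above p.
  move=> z Fz; have [pz vz] := Fz; split=> //.
  have Cz : C z by apply: sub; split=> //; exact: lt_trans pz.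
  move: Ip Iv; rewrite IE => -[_ H1 _] [_ _ H2]; split=> //.
    by case: lo H1 {IE Clo} => // q H1; exact: lt_trans pz.
  case: hi H2 {IE Chi} => // q H2; apply: lt_trans H2.
  exact: (proj2 lpv).
wlog F1 : O1 O2 D1 D2 o1 o2 cov dis / fat p v `<=` O1.
  move=> H; have [||F1|F2] := dconnected_fat lpv D1 D2 o1 o2.
  - by move=> z /Fsub /cov.
  - by move=> z /Fsub; exact: dis.
  - exact: H.
  - rewrite orC; apply: H => //; first by move=> z /cov; rewrite setUC.
    by move=> z Iz ? ?; exact: (dis z).
left.
have [||||||H|H] := cI (side p `|` fat u v `|` (above p `&` O1)) (I `&` above p
  `&` O2).
- by apply: tameU; [exact: tameU|exact: tameI].
- by apply: tameI => //; exact: tameI.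
- by apply: openU; [exact: openU|exact: openI].
- by apply: openI => //; exact: openI.
- move=> z Iz; case: (cut3 p z) => pz.
  + have [|O1z|O2z] := cov z; first by [].
      by left; right.
    by right.
  + by left; left; right; rewrite pz; split=> //; exact: lt_side.
  + by left; left; left.
- move=> z Iz [[[_ /(_ _)n]|Fz]|[pz O1z]] [[_ pz'] O2z].
  + exact: n.
  + apply: (dis z) => //; apply: F1; split=> //.
    by case: Fz.
  + exact: (dis z).
- move=> z [Iz pz]; have [[[_ /(_ pz)//]|[_ vz]]|[]//] := H z Iz.
  exact: F1.
- by have [[_ /lt_irr]] := H p Ip.
Qed.

(** The mirror image of [connected_itv_above], with the arc [fat u p] just below [p]. *)
Lemma connected_itv_below I p : connected_itv I -> I p ->
  connected_itv (I `&` side p).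
Proof.
move=> [cI [lo [hi [Clo Chi IE]]]] Ip.
have oI : open I by rewrite IE; exact: open_itv.
have DI : D I by rewrite IE; exact: tame_itv.
have IC : I `<=` C by rewrite IE => x [].
have Cp : C p by exact: IC.
split; last first.
  exists lo, (Some p); split=> //; rewrite IE; apply/seteqP; split=> x.
    by move=> [[Cx H1 H2] px]; split=> //; apply/component_lt_side.
  move=> [Cx H1 xp]; split; last exact: lt_side.
  split=> //; case: hi {Chi} IE => // q IE; apply: lt_trans xp _.
  by move: Ip; rewrite IE => -[].
move=> O1 O2 D1 D2 o1 o2 cov dis.
have [u [v [[Cu Cv] [Iu Iv] [up pv] [sub lup lpv]]]] := shrink Cp oI Ip.
have Fsub : fat u p `<=` I `&` side p.
  move=> z Fz; have [uz pz] := Fz; split=> //.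
  have zp : lt z p by exact: (proj2 lup).
  have Cz : C z by apply: sub; split=> //; apply: lt_side; exact: lt_trans pv.
  move: Ip Iu; rewrite IE => -[_ _ H2] [_ H1 _]; split=> //.
    by case: lo H1 {IE Clo} => // q H1; exact: lt_trans uz.
  by case: hi H2 {IE Chi} => // q H2; exact: lt_trans H2.
wlog F1 : O1 O2 D1 D2 o1 o2 cov dis / fat u p `<=` O1.
  move=> H; have [||F1|F2] := dconnected_fat lup D1 D2 o1 o2.
  - by move=> z /Fsub /cov.
  - by move=> z /Fsub; exact: dis.
  - exact: H.
  - rewrite orC; apply: H => //; first by move=> z /cov; rewrite setUC.
    by move=> z Iz ? ?; exact: (dis z).
left.
have [||||||H|H] := cI (above p `|` fat u v `|` (side p `&` O1)) (I `&` side p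
  `&` O2).
- by apply: tameU; [exact: tameU|exact: tameI].
- by apply: tameI => //; exact: tameI.
- by apply: openU; [exact: openU|exact: openI].
- by apply: openI => //; exact: openI.
- move=> z Iz; case: (cut3 p z) => pz.
  + by left; left; left.
  + by left; left; right; rewrite pz; split=> //; exact: lt_side.
  + have [|O1z|O2z] := cov z; first by [].
      by left; right.
    by right.
- move=> z Iz [[pz|Fz]|[pz O1z]] [[_ pz'] O2z].
  + exact: side_nlt pz' pz.
  + apply: (dis z) => //; apply: F1; split=> //.
    by case: Fz.
  + exact: (dis z).
- move=> z [Iz pz]; have [[/(side_nlt pz)//|[uz _]]|[]//] := H z Iz.
  exact: F1.
- by have [[_ []]] := H p Ip.
Qed.

Notation pai := (points_and_intervals C lt).

Lemma pai_set0 : pai set0.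
Proof.
exists set0, 0, (fun=> None), (fun=> None); split=> //.
by apply/seteqP; split=> // x [//|[[]]].
Qed.

Lemma pai_set1 p : pai [set p].
Proof.
exists [set p], 0, (fun=> None), (fun=> None); split=> //.
apply/seteqP; split; first by move=> x ?; left.
by move=> x [//|[[]]].
Qed.

Lemma pai_itv lo hi : endpoint C lo -> endpoint C hi -> pai (itv lo hi).
Proof.
move=> Clo Chi; exists set0, 1, (fun=> lo), (fun=> hi); split=> //.
apply/seteqP; split; first by move=> x ?; right; exists ord0.
by move=> x [//|[]].
Qed.

Lemma paiU A B : pai A -> pai B -> pai (A `|` B).
Proof.
move=> [F [n [lo [hi [finF HC ->]]]]] [F' [n' [lo' [hi' [finF' HC' ->]]]]].
exists (F `|` F'), (n + n').
exists (fun i => match fintype.split i with inl j => lo j | inr j => lo' j end).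
exists (fun i => match fintype.split i with inl j => hi j | inr j => hi' j end).
split; first by rewrite finite_setU.
  by move=> i; case: (fintype.split i).
apply/seteqP; split=> x.
  move=> [[?|[i _ Hi]]|[?|[i _ Hi]]].
  - by left; left.
  - by right; exists (lshift n' i) => //; rewrite (unsplitK (inl i)).
  - by left; right.
  - by right; exists (rshift n i) => //; rewrite (unsplitK (inr i)).
move=> [[?|?]|[i _]]; [by left; left|by right; left|].
by case: (fintype.split i) => j H; [left|right]; right; exists j.
Qed.

(** Induction on the number of boundary points of [S] in a connected interval. Without any, the
    interval is inside [S] or disjoint from it; otherwise it is cut at one of them, and both halves
    contain fewer. *)
Lemma definable_pai S : D S -> S `<=` C -> pai S.
Proof.
move=> DS SC; have [s Hs] := proj1 (finite_seqP _) (tame_boundary tm DS).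
suff H n I : connected_itv I -> size [seq b <- s | `[<I b>]] <= n ->
  pai (S `&` I).
  rewrite -(setIidl SC);
    exact: (H (size [seq b <- s | `[<C b>]]) C connected_itv_component).
elim: n I => [|n IH] I nI.
  rewrite leqn0 size_eq0 => /eqP sE.
  have noB x : I x -> (closure S `\` interior S) x -> False.
    rewrite Hs => Ix sx; suff: x \in [seq b <- s | `[<I b>]] by rewrite sE.
    by rewrite mem_filter; apply/andP; split; first exact/asboolP.
  have [cI [lo [hi [Clo Chi IE]]]] := nI.
  have [||||||H|H] := cI (interior S) (interior (~` S)).
  - exact: tame_interior.
  - by apply: (tame_interior tm); exact: tameC.
  - exact: open_interior.
  - exact: open_interior.
  - move=> x Ix; have [ix|nix] := pselect (interior S x); [by left|right].
    by rewrite interiorC => cx; exact: (noB x).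
  - by move=> x _ /interior_subset Sx /interior_subset.
  - rewrite (_ : S `&` I = I); first by rewrite IE; exact: pai_itv.
    by apply: setIidr => x /H /interior_subset.
  - rewrite (_ : S `&` I = set0); first exact: pai_set0.
    by apply/seteqP; split=> // x [Sx /H /interior_subset].
have [/hasP[b bs /asboolP Ib] sz|nh] := boolP (has (fun b => `[<I b>]) s);
  last first.
  move=> _; apply: IH => //.
  by move: nh; rewrite has_filter negbK => /eqP ->.
have dec J : J `<=` I -> ~ J b -> size [seq b <- s | `[<J b>]] <= n.
  move=> JI nJb; rewrite -ltnS; apply: leq_trans sz.
  rewrite !size_filter.
  have := count_predC (pred1 b) [seq c <- s | `[<I c>]].
  rewrite -!size_filter => <-; rewrite -filter_predI -filter_predI.
  rewrite -addn1 addnC leq_add//.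
    rewrite size_filter -has_count; apply/hasP; exists b => //=.
    by rewrite eqxx; apply/asboolP.
  rewrite !size_filter; apply: sub_count => c /asboolP Jc /=.
  apply/andP; split; last by apply/asboolP/JI.
  by apply/eqP => e; apply: nJb; rewrite -e.
rewrite (_ : S `&` I = (S `&` (I `&` side b)) `|` (S `&` (I `&` above b)) `|`
  (S `&` [set b])).
  apply: paiU; first apply: paiU.
  - by apply: IH; [exact: connected_itv_below|apply: dec => [x []|[_ []]]].
  - by apply: IH; [exact: connected_itv_above|apply: dec => [x []|[_ /lt_irr]]].
  - have [Sb|nSb] := pselect (S b).
      by rewrite (_ : S `&` _ = [set b]);
        [exact: pai_set1|apply: setIidr => x ->].
    rewrite (_ : S `&` _ = set0); first exact: pai_set0.
    by apply/seteqP; split=> // x [Sx xb]; apply: nSb; rewrite -xb.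
apply/seteqP; split=> x.
  move=> [Sx Ix]; case: (cut3 b x) => bx.
  - by left; right.
  - by right.
  - by left; left.
move=> [[[Sx [Ix _]]|[Sx [Ix _]]]|[Sx xb]]; split=> //.
by rewrite (xb : x = b).
Qed.

(** A definable basis set [B] has finitely many boundary points, so [u] and [v] can be chosen in [B]
    with none of them strictly between [u] and [x] or between [x] and [v]. Both arcs are then
    connected, meet [B] near [x], and stay in [B]. *)
Lemma itv_nbhs V x : open V -> C x -> V x -> exists u v,
  [/\ C u, C v, itv (Some u) (Some v) x & itv (Some u) (Some v) `<=` V].
Proof.
move=> oV Cx Vx; have [B [DB oB Bx BV]] := tame_basis tm oV Vx.
have [s Hs] := proj1 (finite_seqP _) (tame_boundary tm DB).
(* A neighbourhood of [x] inside which no point can pass [b]. *)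
pose N b : set T := (if pselect (lt x b) then side b else setT) `&`
  (if pselect (lt b x) then above b else setT).
have oN b : open (N b).
  apply: openI; first by case: pselect => H //=; exact: openT.
  by case: pselect => H //=; exact: openT.
have Nx b : N b x.
  by split; case: pselect => H //=; exact: lt_side.
have [W [oW Wx WN]] : exists W, [/\ open W, W x & forall b, b \in s ->
  W `<=` N b].
  elim: s {Hs} => [|b s [W [oW Wx WN]]]; first by exists setT; split=> //;
    exact: openT.
  exists (W `&` N b); split; [exact: openI|by split|].
  by move=> c; rewrite inE => /orP[/eqP ->|/WN H] y [Wy Ny] //; exact: H.
have [u [v [[Cu Cv] [[Wu Bu] [Wv Bv]] [ux xv] [_ lux lxv]]]] :=
  shrink Cx (openI oW oB) (conj Wx Bx).
have inB p q : arc p q -> (exists y, fat p q y /\ B y) ->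
    (forall b, b \in s -> ~ fat p q b) -> fat p q `<=` B.
  move=> lpq [y [Fy By]] noB.
  have [||||||H|H] := dconnected_fat lpq (O1 := B) (O2 :=
    interior (~` B)) => //.
  - by apply: (tame_interior tm); exact: tameC.
  - exact: open_interior.
  - move=> z Fz; have [Bz|nBz] := pselect (B z); [by left|right].
    rewrite interiorC => cz; apply: (noB z) => //.
    suff : (closure B `\` interior B) z by rewrite Hs.
    by split=> // /interior_subset.
  - by move=> z _ Bz /interior_subset.
  - by have /interior_subset := H _ Fy.
have xa : x <> a by exact: lt_neq_root_r ux.
have F1 : fat x v `<=` B.
  apply: inB => //.
    have [|||y [[By vy] xy]] := @above_near x (B `&` side v) => //.
    - exact: openI.
    - by split=> //; exact: lt_side.
    - by exists y.
  move=> b bs Fb; have [xb vb] := Fb.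
  have [+ _] := WN b bs v Wv; case: pselect => //= H /side_nlt; apply.
  exact: (proj2 lxv).
have F2 : fat u x `<=` B.
  apply: inB => //.
    have [|||y [[By uy] xy]] := @side_near x (B `&` above u) => //.
    - exact: openI.
    - by exists y.
  move=> b bs Fb; have [ub xb] := Fb.
  have [_] := WN b bs u Wu; case: pselect => [H /= bu|H];
    first exact: (lt_asym ub bu).
  by case: H; exact: (proj2 lux).
exists u, v; split=> // z [Cz uz zv]; apply: BV.
case: (cut3 x z) => xz.
- by apply: F1; split=> //; exact: lt_side.
- by rewrite xz.
- by apply: F2.
Qed.

Lemma component_dense x y : C x -> C y -> lt x y ->
  exists z, [/\ C z, lt x z & lt z y].
Proof.
move=> Cx Cy xy.
have [u [v [[Cu Cv] [xu _] [uy _] _]]] := shrink Cy (cut_open_above co x) xy.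
by exists u.
Qed.

Lemma component_order : [/\ dense_linear_order_on C lt, order_topology_on C lt &
  forall S, D S -> S `<=` C -> pai S].
Proof.
split; last exact: definable_pai.
- split.
  + by move=> x _; exact: lt_irr.
  + by move=> x y z _ _ _; exact: lt_trans.
  + move=> x y Cx Cy; have [H|->|H] := component_chain Cx Cy.
    * by constructor 1.
    * by constructor 2.
    * by constructor 3.
  + by move=> x y; exact: component_dense.
- move=> V VC; rewrite -(open_setSI _ oC) (setIidr VC).
  split=> [oV x Vx|H].
    have [u [v [Cu Cv xI sub]]] := itv_nbhs oV (VC _ Vx) Vx.
    by exists (Some u), (Some v).
  rewrite openE => x Vx; have [lo [hi [Clo Chi Ix sub]]] := H x Vx.
  apply: filterS sub _; apply: open_nbhs_nbhs; split=> //.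
  exact: open_itv.
Qed.

End Component.

End CutOrder.

(** * Clopen partitions, boundaries and cut points *)

Section DefinableSets.
Variables (L : language) (Mt : Type) (Mb : Type) (M : structure L Mt Mb).

Lemma definable_rel (R : Mt -> Mt -> Prop) U : pdef M (fun e =>
  R (e 0) (e 1)) ->
  definable_rel_on M U R.
Proof.
move=> [Q [p [[f Hf] H]]].
pose r s n := if s is St then
  interleave (fun m => if m is 0 then 0 else 1) (fun m => m.+2) n else n.
have [g Hg] := zero_def_ren r (zero_def_sat M f).
exists g, (fun n => p.1 n.-2, p.2) => a b _ _; rewrite -Hg.
apply: (iff_trans (H (fun n => if n is 0 then a else b))).
rewrite Hf; apply/propeqP; congr (sat M _ f).
apply: valuation_eq => -[] //= n; have [m [->|->]] := even_or_odd n.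
  by rewrite !interleave_even; case: m.
by rewrite !interleave_odd.
Qed.

Lemma definable1 (x : Mt) : definable M [set x].
Proof.
apply/pdef_definable; apply: (@pdef_eq _ _ _ M (fun e => e 0) (fun=> x)).
  exact: isterm_var.
exact: isterm_cst.
Qed.

Lemma definableC (A : set Mt) : definable M A -> definable M (~` A).
Proof. by move=> /pdef_definable/pdef_not HA; apply/pdef_definable. Qed.

Lemma definableI (A B : set Mt) :
  definable M A -> definable M B -> definable M (A `&` B).
Proof.
move=> /pdef_definable HA /pdef_definable HB; apply/pdef_definable.
exact: pdef_and HA HB.
Qed.

End DefinableSets.

Section Pieces.
Variables (L : language) (Mt : topologicalType) (Mb : Type).
Variable M : structure L Mt Mb.

Lemma clopen_partition1 (X : set Mt) : definable M X -> X !=set0 ->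
  clopen_partition M X (fun _ : 'I_1 => X).
Proof.
move=> DX X0; split.
- by apply/seteqP; split=> [x []|x Xx] //; exists ord0.
- by move=> i j _ _ _; rewrite !ord1.
- by move=> _; split=> //; split;
    [exact: open_subspaceT|exact: closed_subspaceT].
Qed.

Lemma refine_clopen_partition (X K : set Mt) d (P : 'I_d -> set Mt) i :
  clopen_partition M X P -> definable M K -> @clopen (subspace X) K ->
  P i `&` K !=set0 -> P i `\` K !=set0 -> has_clopen_partition M X d.+1.
Proof.
move=> [PX Ptriv PP] DK [oK cK] K0 K1.
have [_ Di [oi ci]] := PP i.
pose P' (j : 'I_d.+1) := if unlift ord0 j is Some j' then
  (if j' == i then P i `\` K else P j') else P i `&` K.
have P'0 : P' ord0 = P i `&` K by rewrite /P' unlift_none.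
have P'S j : P' (lift ord0 j) = if j == i then P i `\` K else P j.
  by rewrite /P' liftK.
have sub j : P' (lift ord0 j) `<=` P j.
  by rewrite P'S; case: eqP => [->|_] x // [].
exists P'; split.
- apply/seteqP; split=> x.
    move=> [j _]; case: (unliftP ord0 j) => [j' ->|->].
      by move=> /sub Px; rewrite -PX; exists j'.
    by rewrite P'0 => -[Px _]; rewrite -PX; exists i.
  rewrite -PX => -[j _ Pjx]; have [ji|ji] := eqVneq j i.
    rewrite ji in Pjx; have [Kx|Kx] := pselect (K x).
      by exists ord0 => //; rewrite P'0.
    by exists (lift ord0 i) => //; rewrite P'S eqxx.
  by exists (lift ord0 j) => //; rewrite P'S (negbTE ji).
- have dis j x : P' ord0 x -> P' (lift ord0 j) x -> False.
    rewrite P'0 P'S => -[Pix Kx]; case: eqP => [_ []//|ne Pjx].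
    by apply: ne; apply: Ptriv => //; exists x.
  move=> j1 j2 _ _ [x []].
  case: (unliftP ord0 j1) => [j1' ->|->];
    case: (unliftP ord0 j2) => [j2' ->|->] //.
  + move=> /sub H1 /sub H2; congr (lift _ _).
    by apply: Ptriv => //; exists x.
  + by move=> H1 H2; case: (dis j1' x).
  + by move=> H1 H2; case: (dis j2' x).
- move=> j; case: (unliftP ord0 j) => [j' ->|->].
    rewrite P'S; case: eqP => // _; split=> //.
      by apply: definableI => //; exact: definableC.
    split; first by apply: openI => //; exact: closed_openC.
    by apply: closedI => //; exact: open_closedC.
  rewrite P'0; split=> //; first exact: definableI.
  by split; [exact: openI|exact: closedI].
Qed.

(** A clopen set that properly cut a piece would refine the partition to [d.+1] pieces. *)
Lemma piece_dichotomy (X K : set Mt) d (P : 'I_d -> set Mt) i :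
  comp_number M X d -> clopen_partition M X P ->
  definable M K -> @clopen (subspace X) K ->
  P i `<=` K \/ P i `&` K `<=` set0.
Proof.
move=> [_ max] HP DK clK; apply: contrapT => /not_orP[n1 n2].
suff /max : has_clopen_partition M X d.+1 by rewrite ltnn.
apply: (refine_clopen_partition HP DK clK (i := i)).
  by apply/set0P/eqP => e; apply: n2; rewrite e.
by apply/set0P/eqP => e; apply: n1; rewrite -setD_eq0.
Qed.

Lemma clopen_in_open (X K : set Mt) : open X -> K `<=` X ->
  open K -> open (X `\` K) -> @clopen (subspace X) K.
Proof.
move=> oX KX oK oXK; split; first exact: open_subspaceW.
apply/closed_subspaceP; exists (~` (X `\` K)); first exact: open_closedC.
apply/seteqP; split=> x [H Xx]; split=> //.
  by apply: contrapT => nK; apply: H.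
by case.
Qed.

Lemma clopen_in_openP (X K : set Mt) : open X -> K `<=` X ->
  @clopen (subspace X) K -> open K /\ open (X `\` K).
Proof.
move=> oX KX [oK cK]; split.
  by move: oK; rewrite -(open_setSI _ oX) (setIidr KX).
by move: (closed_openC cK); rewrite -(open_setSI _ oX).
Qed.

Lemma no_clopen X : definable M X -> def_connected M X ->
  forall K, definable M K -> K `<=` X -> @clopen (subspace X) K ->
  K = set0 \/ K = X.
Proof.
move=> DX cX K DK KX clK; apply: contrapT => /not_orP[n0 nX]; apply: cX.
have K0 : K !=set0 by apply/set0P/eqP.
have X0 : X !=set0 by case: K0 => x /KX; exists x.
apply: (refine_clopen_partition (clopen_partition1 DX X0) DK clK (i := ord0)).
  by rewrite (setIidr KX).
apply/set0P/eqP => e; apply: nX.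
by apply/seteqP; split=> //; rewrite -setD_eq0.
Qed.

End Pieces.

Section Boundary.
Variables (L : language) (Mt : topologicalType) (Mb : Type).
Variables (M : structure L Mt Mb) (phi : formula L) (k : nat).
Hypotheses (HM : ttt M phi k) (dim1 : one_dimensional M).

Lemma closed_point (x : Mt) : closed [set x].
Proof. by case: HM => _ /hausdorff_accessible/accessible_closed_set1. Qed.

(** If [y] were not isolated in [Y], the singleton of [y], the set [Y] and the whole space would
    each lack interior in the next, giving rank at least 2. So all points are isolated, and each
    piece of a maximal partition is a single point. *)
Lemma finite_nowhere_dense (Y : set Mt) : closed Y -> definable M Y ->
  interior Y = set0 -> finite_set Y.
Proof.
case: HM => fo _ _ _ fin cY DY iY.
have iso y : Y y -> @clopen (subspace Y) [set y].
  move=> Yy; split; last by apply: closed_subspaceW; exact: closed_point.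
  have sub : @interior (subspace Y) [set y] `<=` [set y] by exact:
    interior_subset.
  have [i0|/eqP/set0P[z iz]] := pselect (@interior (subspace Y) [set y] = set0).
    exfalso; case: dim1 => _; apply.
    have s01 : succ_of (0 : nat) 1 by split=> // -[].
    have s12 : succ_of (1 : nat) 2 by split=> // -[|[]].
    have iT : @interior (subspace setT) Y = set0.
      by rewrite -iY; apply/funext => z; rewrite /interior nbhs_subspaceT.
    apply: (rank_ge_succ s12 cY DY _ iT) => //.
    apply: (rank_ge_succ s01 (@closed_point y) (definable1 M y) _ i0).
      by move=> z ->.
    by apply: rank_ge_zero => //; exists y.
  have -> : [set y] = @interior (subspace Y) [set y].
    apply/seteqP; split=> // x ->.
    by move: (iz); rewrite (sub _ iz : z = y).
  exact: open_interior.
have [d Hd] := fin Y DY; have [[P HP] _] := Hd; have [PY _ PP] := HP.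
rewrite -PY; apply: bigcup_finite; first exact: finite_finset.
move=> i _; have [[y Py] _ _] := PP i.
have Yy : Y y by rewrite -PY; exists i.
have [H|H] := piece_dichotomy i Hd HP (definable1 M y) (iso y Yy).
  exact: sub_finite_set H (finite_set1 y).
by have [] := H y.
Qed.

(** Induction on the Boolean combination. The boundary of an open definable set is closed, definable
    and without interior; complements have the same boundary, and that of a union is covered by
    those of its parts. *)
Lemma finite_boundary (X : set Mt) : definable M X ->
  finite_set (closure X `\` interior X).
Proof.
case: HM => fo _ bc _ _ /bc; elim=> {X} [U [DU oU]|A _ IH|A B _ IHA _ IHB].
- have DcU : definable M (closure U).
    rewrite -(setCK (closure U)) -interiorC; apply: definableC.
    by apply: (definable_interior fo); exact: definableC.
  apply: finite_nowhere_dense.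
  + apply: closedI; first exact: closed_closure.
    by apply: open_closedC; exact: open_interior.
  + apply: definableI => //; apply: definableC.
    exact: (definable_interior fo).
  + apply/seteqP; split=> // x ix; have [cx _] := interior_subset ix.
    have [y [Uy]] := cx _ ix; rewrite (_ : interior U = U) => [[_]//|].
    exact/interior_id.
- rewrite closure_setC interiorC setDE setCK setIC.
  exact: IH.
- apply: sub_finite_set (_ : finite_set ((closure A `\` interior A) `|`
    (closure B `\` interior B))); last by rewrite finite_setU.
  move=> x [+ ni]; rewrite closureU => -[cx|cx]; [left|right]; split=> // ix.
    by apply: ni; apply: filterS ix => z; left.
  by apply: ni; apply: filterS ix => z; right.
Qed.

Lemma tame_definable : def_connected M setT -> tame (definable M).
Proof.
case: HM => fo _ _ _ _ conn; split.
- exact: closed_point.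
- exact: definable1.
- exact: definableC.
- exact: definableI.
- by move=> A; exact: (definable_interior fo).
- move=> O x oO Ox; have [ob bas] := proj2 fo.
  have [B [[v BE] Bx] BO] := bas x O (open_nbhs_nbhs (conj oO Ox)).
  exists B; split=> //; first by exists phi, v.
  by apply: ob; exists v.
- exact: finite_boundary.
- move=> K DK oK cK; apply: (no_clopen _ conn DK) => //.
    rewrite -setC0 -(setICr K); apply: definableC; apply: definableI => //.
    exact: definableC.
  by apply: clopen_in_open => //; [exact: openT|rewrite setTD;
    exact: closed_openC].
Qed.

End Boundary.

(** * The separation order given by finitely many formulas *)

Section CutPoints.
Variables (L : language) (Mt : topologicalType) (Mb : Type).
Variables (M : structure L Mt Mb) (phi : formula L) (k : nat).
Hypothesis HM : ttt M phi k.
Hypothesis cut : forall x : Mt,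
  exists2 d : nat, comp_number M (~` [set x]) d & 1 < d.

Lemma open_punctured (x : Mt) : open (~` [set x]).
Proof. by apply: closed_openC; exact: (closed_point HM). Qed.

Lemma separated_points x : exists f a y, separates M f x a y.
Proof.
have [d [[P [PX Ptriv PP]] _] d1] := cut x.
pose i0 := Ordinal (ltnW d1); pose i1 := Ordinal d1.
have [[p Pp] [f [w Pf]] cl0] := PP i0.
have [[q Pq] _ _] := PP i1.
have sub i : P i `<=` ~` [set x] by rewrite -PX => z ?; exists i.
have [op0 oc0] := clopen_in_openP (open_punctured x) (sub i0) cl0.
exists f, p, q, w; rewrite -Pf; split.
- split=> //; first by move=> /sub; apply.
  rewrite (_ : [set z | _] = ~` [set x] `\` P i0)//.
  by apply/seteqP; split=> z [].
- by move=> e; apply: (sub _ _ Pp).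
- by move=> e; apply: (sub _ _ Pq).
- split=> // _ P0q; have /(congr1 val) // : i0 = i1.
  by apply: Ptriv => //; exists q.
Qed.

Variables (m : nat) (F : 'I_m -> formula L) (a : Mt).
Hypothesis unif : forall x, exists i p q, separates M (F i) x p q.

Definition cut_lt x y := exists i, separates M (F i) x a y.

Lemma pdef_cut_lt : pdef M (fun e => cut_lt (e 0) (e 1)).
Proof.
case: HM => fo _ _ _ _.
apply: (@pdef_app3 _ _ _ M (fun x y z => exists i, separates M (F i) x y z)
  (fun e => e 0) (fun=> a) (fun e => e 1)).
- exact: (pdef_separates fo).
- exact: isterm_var.
- exact: isterm_cst.
- exact: isterm_var.
Qed.

(** Infinitely many cuts at [x] may arise as the parameters vary, but none of them divides a piece
    of a maximal partition of the complement of [x]. So the piece containing [y] is a neighbourhood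
    whose points are all on the root side. *)
Lemma open_side_cut x : open (side cut_lt x).
Proof.
have [d Hd _] := cut x; have [[P HP] _] := Hd; have [PX _ PP] := HP.
have sub i : P i `<=` ~` [set x] by rewrite -PX => z ?; exists i.
rewrite openE => y [yx nlt].
have [i _ Piy] : (\bigcup_i P i) y by rewrite PX.
have [_ _ /(clopen_in_openP (open_punctured x) (sub i))[oPi _]] := PP i.
apply: (@filterS _ _ _ (P i)); last exact: open_nbhs_nbhs.
move=> z Piz; split; first exact: (sub i).
move=> [j [w [[nx oS oS'] ax zx E]]]; apply: nlt.
exists j, w; split=> //.
have sS : solset M (F j) w `<=` ~` [set x] by move=> t St e; apply: nx;
  rewrite -e.
have cl : @clopen (subspace (~` [set x])) (solset M (F j) w).
  apply: clopen_in_open => //; first exact: open_punctured.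
  rewrite (_ : _ `\` _ = [set z | ~ solset M (F j) w z /\ z <> x])//.
  by apply/seteqP; split=> t [].
have Dw : definable M (solset M (F j) w) by exists (F j), w.
have [H|H] := piece_dichotomy i Hd HP Dw cl.
  by rewrite E; split=> nS _; apply: nS; exact: H.
have nS t : P i t -> ~ solset M (F j) w t by move=> Pt St; exact: (H t).
by rewrite E; split=> _; [exact: (nS y)|exact: (nS z)].
Qed.

Lemma cut_order_cut_lt : cut_order (definable M) a cut_lt.
Proof.
split.
- by move=> x [i [w []]].
- by move=> x [i [w [_ _ _ [H1 H2]]]]; have nS Sa : False := H1 Sa Sa;
    apply: (nS); apply: H2 => /nS.
- by move=> x [i [w []]].
(* Of two points on opposite sides of a cut, at least one is separated from [a]. *)
- move=> x xa; have [i [p [q [w [cw px qx E]]]]] := unif x.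
  have [H|H] := pselect (solset M (F i) w a <-> ~ solset M (F i) w p).
    by exists p, i, w; split=> //; exact/nesym.
  exists q, i, w; split=> //; first exact/nesym.
  have [Sa|nSa] := pselect (solset M (F i) w a).
    split=> // _; apply/E; apply: contrapT => np; apply: H; split=> // _.
  split=> // nq; exfalso; apply: H; split=> // np.
  by case: np; apply/E.
- move=> x; rewrite openE => y [i [w [[nx oS oS'] ax yx E]]].
  have [Sa|nSa] := pselect (solset M (F i) w a).
    apply: (@filterS _ _ _ [set z | ~ solset M (F i) w z /\ z <> x]).
      by move=> z [nz zx]; exists i, w; split.
    apply: open_nbhs_nbhs; split=> //; split=> //.
    exact/E.
  apply: (@filterS _ _ _ (solset M (F i) w)).
    move=> z Sz; exists i, w; split=> //.
    by move=> e; apply: nx; rewrite -e.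
  apply: open_nbhs_nbhs; split=> //.
  by apply: contrapT => /E.
- exact: open_side_cut.
- move=> x; apply/pdef_definable.
  apply: (@pdef_app2 _ _ _ M cut_lt (fun=> x) (fun e => e 0)).
  + exact: pdef_cut_lt.
  + exact: isterm_cst.
  + exact: isterm_var.
- move=> x; apply/pdef_definable.
  apply: (@pdef_app2 _ _ _ M cut_lt (fun e => e 0) (fun=> x)).
  + exact: pdef_cut_lt.
  + exact: isterm_var.
  + exact: isterm_cst.
- have [d [[P [PX _ PP]] _] d1] := cut a.
  have [[p Pp] _ _] := PP (Ordinal d1); exists p.
  have : (\bigcup_i P i) p by exists (Ordinal d1).
  by rewrite PX.
Qed.

Lemma pdef_lt i j : pdef M (fun e => cut_lt (e i) (e j)).
Proof.
apply: (@pdef_app2 _ _ _ M cut_lt (fun e => e i) (fun e => e j)).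
- exact: pdef_cut_lt.
- exact: isterm_var.
- exact: isterm_var.
Qed.

Lemma pdef_fat i j l : pdef M (fun e => fat cut_lt (e i) (e j) (e l)).
Proof.
apply: pdef_and; first exact: pdef_lt.
apply: pdef_and; last by apply: pdef_not; exact: pdef_lt.
by apply: pdef_not; apply: pdef_eq; exact: isterm_var.
Qed.

Lemma definable_good : definable M (good cut_lt).
Proof.
apply/pdef_definable; apply: pdef_ex; apply: pdef_ex.
apply: pdef_and; last exact: pdef_fat.
apply: pdef_and; first exact: pdef_lt.
apply: pdef_all; apply: pdef_imp; first exact: pdef_fat.
exact: pdef_lt.
Qed.

End CutPoints.

(** * Definable components of an open set *)

Section Components.
Variables (L : language) (Mt : topologicalType) (Mb : Type).
Variable M : structure L Mt Mb.

Lemma def_component_spec (G C : set Mt) : open G -> def_component M G C ->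
  [/\ C !=set0, C `<=` G, definable M C, open C & open (G `\` C)].
Proof.
move=> oG [d [P [_ [PG _ PP] [i ->]]]].
have sub : P i `<=` G by rewrite -PG => x ?; exists i.
have [P0 DP clP] := PP i.
by have [? ?] := clopen_in_openP oG sub clP; split.
Qed.

Lemma def_component_dichotomy (G C K : set Mt) : def_component M G C ->
  definable M K -> @clopen (subspace G) K -> C `<=` K \/ C `&` K `<=` set0.
Proof.
by move=> [d [P [cG HP [i ->]]]]; exact: piece_dichotomy.
Qed.

(** The trace of [O1] on [C] is clopen in [G], its complement there being the open set made of [G]
    minus [C] and the trace of [O2]. As a piece of a maximal partition, [C] cannot be cut by it. *)
Lemma dconnected_component (G C : set Mt) : open G -> def_component M G C ->
  dconnected (definable M) C.
Proof.
move=> oG HC O1 O2 D1 D2 o1 o2 cov dis.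
have [_ CG DC oC oGC] := def_component_spec oG HC.
have [||H|H] := def_component_dichotomy (K := C `&` O1) HC.
- exact: definableI.
- apply: clopen_in_open => //; [by move=> x [/CG]|exact: openI|].
  rewrite (_ : _ `\` _ = (G `\` C) `|` (C `&` O2)).
    by apply: openU => //; exact: openI.
  apply/seteqP; split=> x.
    move=> [Gx n]; have [Cx|nCx] := pselect (C x); last by left.
    by right; split=> //; have [O1x|//] := cov x Cx; case: n.
  move=> [[Gx nCx]|[Cx O2x]]; split=> //; first by case.
    exact: CG.
  by move=> [_ O1x]; exact: (dis x).
- by left=> x /H[].
- right=> x Cx; have [O1x|//] := cov x Cx.
  by have [] := H x.
Qed.

(** Each component may come from its own maximal partition. Pieces of two such partitions that meet
    are equal by the dichotomy, so one fixed partition lists all components. *)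
Lemma finite_components (G : set Mt) : open G ->
  (exists d, comp_number M G d) ->
  finite_set [set C | def_component M G C].
Proof.
move=> oG [d Hd]; have [[P HP] _] := Hd; have [PG _ PP] := HP.
have HPi i : def_component M G (P i) by exists d, P; split=> //; exists i.
have clop C : def_component M G C -> @clopen (subspace G) C.
  by move=> /(def_component_spec oG)[_ ? _ ? ?]; exact: clopen_in_open.
apply: (@sub_finite_set _ _ (range P)); last exact/finite_image/finite_finset.
move=> C /= HC; have [[x Cx] CG DC _ _] := def_component_spec oG HC.
have [i _ Px] : (\bigcup_i P i) x by rewrite PG; exact: CG.
exists i => //; apply/seteqP; split.
  have [//|H] := def_component_dichotomy (HPi i) DC (clop _ HC).
  by have [] := H x.
have [_ _ DP _ _] := def_component_spec oG (HPi i).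
have [//|H] := def_component_dichotomy HC DP (clop _ (HPi i)).
by have [] := H x.
Qed.

End Components.

Theorem theorem4p21 (L : language) (Mt : topologicalType) (Mb : Type)
    (M : structure L Mt Mb) (phi : formula L) (k : nat) :
  ttt M phi k ->
  one_dimensional M ->
  def_connected M [set: Mt] ->
  omega_saturated M ->
  (forall x : Mt, exists2 d : nat, comp_number M (~` [set x]) d & 1 < d) ->
  exists X : set Mt,
    [/\ finite_set X,
        finite_set [set C | def_component M (~` X) C] &
        forall C : set Mt, def_component M (~` X) C -> o_minimal M C].
Proof.
move=> HM dim1 conn sat cut.
have [fo _ _ _ fin] := HM; case: (inh_t M) => a.
(* Finiteness of the family [F] is what makes [lt] definable. *)
have [m [F unif]] := uniform_separation fo sat (separated_points HM cut).
pose lt := cut_lt M F a.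
have tm := tame_definable HM dim1 conn.
have co : cut_order (definable M) a lt := cut_order_cut_lt HM cut a unif.
have Dg : definable M (good lt) by exact: (definable_good HM F a).
have og : open (good lt) by exact: (open_good co).
(* The removed points are those without an arc as neighbourhood. *)
exists (~` good lt); rewrite setCK; split.
- apply: (finite_bad tm co Dg) => O DO Hch.
  apply: (saturated_chain sat _ Hch); apply: pdef_and.
    apply: (@pdef_app1 _ _ _ M O (fun e => e 0)); last exact: isterm_var.
    exact/pdef_definable.
  exact: (pdef_cut_lt HM).
- by apply: finite_components => //; exact: fin.
- move=> C HC; have [_ CG DC oC oGC] := def_component_spec og HC.
  split=> //; exists lt.
  have DgC : definable M (good lt `\` C).
    by apply: definableI => //; exact: definableC.
  have [dlo ot pai] := component_order tm co DC oC (dconnected_component og HC)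
    CG DgC oGC.
  by split=> //; apply: definable_rel; exact: (pdef_cut_lt HM).
Qed.
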